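(* The binary relation $\approx$ between Boolean circuits, defined by $A \approx B$ iff $\mathrm{Fla}[A] \sim_{\mathrm{BA}} \mathrm{Fla}[B]$, is decidable in polynomial time (in the sizes of the circuits $A$, $B$).
   Context: The DeMorgan language has constants $0,1$, unary $\neg$ and binary $\vee,\wedge$. Formulas are terms in this language. A size $s$ circuit $C$ with inputs $x_1,\dots,x_n$ is specified by a straight line program computing gates $y_1,\dots,y_s$: each $y_j$ is defined to be an input or a constant, or is computed from $y_{j_1}$ with $j_1<j$ by $\neg$, or from $y_{j_1}, y_{j_2}$ with $j_1<j_2<j$ by $\vee$ or $\wedge$. The last gate $y_s$ is the output gate and is the only gate of out-degree $0$. The program determines an ordering (left, right) of the wires entering a gate. $\mathrm{Fla}[C]$ is the unique formula obtained by unwinding $C$ (in general exponentially larger than $C$): $\mathrm{Fla}[C]:=C$ if $C$ is an input variable or a constant, $\mathrm{Fla}[\neg C]:=\neg \mathrm{Fla}[C]$, and $\mathrm{Fla}[C\circ D]:=\mathrm{Fla}[C]\circ\mathrm{Fla}[D]$ for $\circ\in\{\vee,\wedge\}$ (with the order of the two subcircuits determined by the order of wires). BA is the following set of equations between DeMorgan terms: $\neg 0=1$, $\neg 1=0$, $0\vee a=a$, $1\wedge a=a$; $a\vee\neg a=1$, $a\wedge\neg a=0$; $a\vee b=b\vee a$, $a\wedge b=b\wedge a$; $a\vee(b\vee c)=(a\vee b)\vee c$, $a\wedge(b\wedge c)=(a\wedge b)\wedge c$; $a\vee(b\wedge c)=(a\vee b)\wedge(a\vee c)$, $a\wedge(b\vee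 c)=(a\wedge b)\vee(a\wedge c)$. For terms $s,t$ write $s\sim_{\mathrm{BA}} t$ iff there exist terms $w(y),u,v$, where $y$ does not occur in $s,t$, and a substitution $\sigma$ for the variables in $u,v$ such that: one of the equations $u=v$ or $v=u$ is in BA; $y$ has exactly one occurrence in $w$; $s$ is syntactically identical to $w(y/\sigma(u))$; and $t$ is syntactically identical to $w(y/\sigma(v))$. *)

(* Defs.v *)
From HB Require Import structures.
From mathcomp Require Import all_boot all_order all_algebra.

Set Implicit Arguments.
Unset Strict Implicit.
Unset Printing Implicit Defensive.

(** * DeMorgan terms and the relation [simBA] *)

Inductive term : Type :=
| Var of nat
| Cst of bool
| Neg of term
| Or of term & term
| And of term & term.

Fixpoint subst (sigma : nat -> term) (t : term) : term :=
  match t with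
  | Var x => sigma x
  | Cst b => Cst b
  | Neg t1 => Neg (subst sigma t1)
  | Or t1 t2 => Or (subst sigma t1) (subst sigma t2)
  | And t1 t2 => And (subst sigma t1) (subst sigma t2)
  end.

Definition subst1 (w : term) (y : nat) (r : term) : term :=
  subst (fun z => if z == y then r else Var z) w.

Fixpoint occ (y : nat) (t : term) : nat :=
  match t with
  | Var x => x == y
  | Cst _ => 0
  | Neg t1 => occ y t1
  | Or t1 t2 | And t1 t2 => occ y t1 + occ y t2
  end.

Inductive BA : term -> term -> Prop :=
| BA_neg0 : BA (Neg (Cst false)) (Cst true)
| BA_neg1 : BA (Neg (Cst true)) (Cst false)
| BA_or0 : BA (Or (Cst false) (Var 0)) (Var 0)
| BA_and1 : BA (And (Cst true) (Var 0)) (Var 0)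
| BA_orN : BA (Or (Var 0) (Neg (Var 0))) (Cst true)
| BA_andN : BA (And (Var 0) (Neg (Var 0))) (Cst false)
| BA_orC : BA (Or (Var 0) (Var 1)) (Or (Var 1) (Var 0))
| BA_andC : BA (And (Var 0) (Var 1)) (And (Var 1) (Var 0))
| BA_orA : BA (Or (Var 0) (Or (Var 1) (Var 2)))
              (Or (Or (Var 0) (Var 1)) (Var 2))
| BA_andA : BA (And (Var 0) (And (Var 1) (Var 2)))
               (And (And (Var 0) (Var 1)) (Var 2))
| BA_orD : BA (Or (Var 0) (And (Var 1) (Var 2)))
              (And (Or (Var 0) (Var 1)) (Or (Var 0) (Var 2)))
| BA_andD : BA (And (Var 0) (Or (Var 1) (Var 2)))
               (Or (And (Var 0) (Var 1)) (And (Var 0) (Var 2))).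

Definition simBA (s t : term) : Prop :=
  exists (w : term) (y : nat) (u v : term) (sigma : nat -> term),
    [/\ occ y s = 0 /\ occ y t = 0,
        BA u v \/ BA v u,
        occ y w = 1,
        s = subst1 w y (subst sigma u)
      & t = subst1 w y (subst sigma v)].

(** * Circuits *)

(* Gates and inputs are numbered from 0.  In [GOr j1 j2] and [GAnd j1 j2] the
   left wire comes from gate [j1] and the right wire from gate [j2]. *)
Inductive gate : Type :=
| GInput of nat
| GConst of bool
| GNot of nat
| GOr of nat & nat
| GAnd of nat & nat.

Definition gate_wf (n j : nat) (g : gate) : bool :=
  match g with
  | GInput i => i < n
  | GConst _ => true
  | GNot j1 => j1 < j
  | GOr j1 j2 | GAnd j1 j2 => j1 < j2 < j
  end.

Definition wires (g : gate) : seq nat :=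
  match g with
  | GInput _ | GConst _ => [::]
  | GNot j1 => [:: j1]
  | GOr j1 j2 | GAnd j1 j2 => [:: j1; j2]
  end.

(* The last gate has out-degree 0 by [circuit_wf]; [circuit_out] says that it
   is the only one. *)
Record circuit (n : nat) : Type := Circuit {
  gates :> seq gate;
  circuit_gt0 : 0 < size gates;
  circuit_wf : forall j, j < size gates ->
    gate_wf n j (nth (GConst false) gates j);
  circuit_out : forall j, j < (size gates).-1 ->
    has (fun g => j \in wires g) gates
}.

Definition gate_fla (fs : seq term) (g : gate) : term :=
  match g with
  | GInput i => Var i
  | GConst b => Cst b
  | GNot j1 => Neg (nth (Cst false) fs j1)
  | GOr j1 j2 => Or (nth (Cst false) fs j1) (nth (Cst false) fs j2)
  | GAnd j1 j2 => And (nth (Cst false) fs j1) (nth (Cst false) fs j2)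
  end.

Definition unwind (gs : seq gate) : seq term :=
  foldl (fun fs g => rcons fs (gate_fla fs g)) [::] gs.

Definition Fla (n : nat) (C : circuit n) : term :=
  last (Cst false) (unwind C).

Definition approx (n m : nat) (A : circuit n) (B : circuit m) : Prop :=
  simBA (Fla A) (Fla B).

(** * Codes of pairs of circuits *)

Inductive symbol : Type :=
| SBit of bool
| SInput
| SConst of bool
| SNot
| SOr
| SAnd
| SComma
| SSep.

Definition symbol_code (s : symbol) : bool + (bool + 'I_6) :=
  match s with
  | SBit b => inl b
  | SConst b => inr (inl b)
  | SInput => inr (inr (@Ordinal 6 0 isT))
  | SNot => inr (inr (@Ordinal 6 1 isT))
  | SOr => inr (inr (@Ordinal 6 2 isT))
  | SAnd => inr (inr (@Ordinal 6 3 isT))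
  | SComma => inr (inr (@Ordinal 6 4 isT))
  | SSep => inr (inr (@Ordinal 6 5 isT))
  end.

Definition symbol_decode (c : bool + (bool + 'I_6)) : symbol :=
  match c with
  | inl b => SBit b
  | inr (inl b) => SConst b
  | inr (inr i) => nth SSep [:: SInput; SNot; SOr; SAnd; SComma; SSep] i
  end.

Lemma symbol_codeK : cancel symbol_code symbol_decode.
Proof. by case. Qed.

HB.instance Definition _ := Finite.copy symbol (can_type symbol_codeK).

(* Binary notation, least significant bit first, without superfluous zeros:
   [up_log 2 n.+1] is the bit length of [n]. *)
Definition binary (n : nat) : seq symbol :=
  [seq SBit (odd (n %/ 2 ^ i)) | i <- iota 0 (up_log 2 n.+1)].

Definition encode_gate (g : gate) : seq symbol :=
  match g with
  | GInput i => SInput :: binary i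
  | GConst b => [:: SConst b]
  | GNot j1 => SNot :: binary j1
  | GOr j1 j2 => SOr :: binary j1 ++ SComma :: binary j2
  | GAnd j1 j2 => SAnd :: binary j1 ++ SComma :: binary j2
  end.

Definition encode_gates (gs : seq gate) : seq symbol :=
  flatten [seq encode_gate g | g <- gs].

Definition encode_pair (gs hs : seq gate) : seq symbol :=
  encode_gates gs ++ SSep :: encode_gates hs.

(* The length of a code is bounded by a polynomial in the sizes of the
   circuits and the bit lengths of the input names. *)
Lemma size_encode_gates n (A : circuit n) (s : nat) : n + size A <= s ->
  size (encode_gates A) <= size A * (up_log 2 s).+1.*2.
Proof.
move=> le_s; rewrite /encode_gates size_flatten sumnE /shape -map_comp big_map.
have bits i : i < s -> size (binary i) <= up_log 2 s.
  by move=> lt_i; rewrite size_map size_iota leq_up_log.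
rewrite (big_nth (GConst false)) big_mkord -[X in X * _]card_ord.
rewrite -sum_nat_const; apply: leq_sum => j _ /=.
have lt_j : j < s by apply: leq_trans (ltn_ord j) (leq_trans (leq_addl _ _) le_s).
have bnd i k : i < s -> k < s ->
  (size (binary i ++ SComma :: binary k)).+1 <= (up_log 2 s).+1.*2.
  move=> lti ltk; rewrite size_cat /= addnS doubleS -addnn !ltnS.
  by rewrite leq_add ?bits.
have bnd1 i : i < s -> (size (binary i)).+1 <= (up_log 2 s).+1.*2.
  move=> lti; apply: leq_trans (bnd i i lti lti).
  by rewrite ltnS size_cat leq_addr.
have := circuit_wf (ltn_ord j); case: (nth _ _ _) => //=.
- by move=> i lti; apply: bnd1; apply: leq_trans lti (leq_trans (leq_addr _ _) le_s).
- by move=> i lti; apply: bnd1; apply: ltn_trans lti lt_j.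
- move=> i k /andP[ltik ltk]; have lks := ltn_trans ltk lt_j.
  by apply: bnd => //; apply: ltn_trans ltik lks.
- move=> i k /andP[ltik ltk]; have lks := ltn_trans ltk lt_j.
  by apply: bnd => //; apply: ltn_trans ltik lks.
Qed.

Lemma size_encode_pair n m (A : circuit n) (B : circuit m) :
  size (encode_pair A B) <=
  ((size A + size B) * (up_log 2 (n + m + size A + size B)).+1.*2).+1.
Proof.
rewrite size_cat /= addnS ltnS mulnDl.
rewrite -(addnA n) -(addnA n) -(addnA m).
apply: leq_add; apply: size_encode_gates.
  by rewrite leq_add2l addnCA leq_addr.
by apply: leq_trans (leq_addl n _); rewrite leq_add2l leq_addl.
Qed.

(** * Polynomial time *)

Inductive move : Type := MoveL | Stay | MoveR.

(* A tape infinite in both directions: the cells left of the head (nearest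
   first), the scanned cell, and the cells right of the head (nearest first).
   Cells that are not listed are blank. *)
Record tape (G : Type) : Type := Tape {
  tape_left : seq (option G);
  tape_head : option G;
  tape_right : seq (option G)
}.

Definition tape_write (G : Type) (a : option G) (T : tape G) : tape G :=
  Tape (tape_left T) a (tape_right T).

Definition tape_move (G : Type) (d : move) (T : tape G) : tape G :=
  let: Tape l a r := T in
  match d with
  | MoveL => Tape (behead l) (head None l) (a :: r)
  | Stay => T
  | MoveR => Tape (a :: l) (head None r) (behead r)
  end.

Definition tape_of (G : Type) (w : seq G) : tape G :=
  let r := map Some w in Tape [::] (head None r) (behead r).

(* Deterministic Turing machines with [tm_ntapes.+1] tapes and input alphabet
   [S].  The tape alphabet is [S + tm_extra] plus the blank [None]; a state [q]
   is final iff [tm_final q] is [Some b], with [b] the answer. *)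
Record TM (S : finType) : Type := MkTM {
  tm_ntapes : nat;
  tm_extra : finType;
  tm_state : finType;
  tm_start : tm_state;
  tm_final : tm_state -> option bool;
  tm_trans : tm_state -> {ffun 'I_tm_ntapes.+1 -> option (S + tm_extra)} ->
    tm_state * {ffun 'I_tm_ntapes.+1 -> option (S + tm_extra) * move}
}.

Definition config (S : finType) (M : TM S) : Type :=
  tm_state M * ('I_(tm_ntapes M).+1 -> tape (S + tm_extra M)).

(* The input is on tape 0, the other tapes are blank. *)
Definition init (S : finType) (M : TM S) (w : seq S) : config M :=
  (tm_start M,
   fun i => if i == ord0 then tape_of (map inl w) else tape_of [::]).

(* Final configurations are fixed, so that running for [t] steps means
   halting within [t] steps. *)
Definition step (S : finType) (M : TM S) (c : config M) : config M :=
  let: (q, T) := c in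
  if tm_final q is Some _ then c else
  let: (q', act) := tm_trans q [ffun i => tape_head (T i)] in
  (q', fun i => tape_move (act i).2 (tape_write (act i).1 (T i))).

Definition answer_after (S : finType) (M : TM S) (t : nat) (w : seq S) :
    option bool :=
  tm_final (iter t (@step S M) (init M w)).1.

(* [L] is decided, on all words, within time polynomial in their length. *)
Definition PTIME (S : finType) (L : seq S -> Prop) : Prop :=
  exists (M : TM S) (p : {poly nat}), forall w : seq S,
    exists b : bool,
      answer_after M (p.[size w])%R w = Some b /\ (b <-> L w).

(* Main.v *)
Require Import Defs.
From mathcomp Require Import all_boot all_order all_algebra zify.
From Stdlib Require Import FunctionalExtensionality.

Set Implicit Arguments.
Unset Strict Implicit.
Unset Printing Implicit Defensive.

(** Two formulas are related by [simBA] when one is obtained from the other by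
    rewriting a single subformula with a single axiom ([simBA_near]).  For the
    formulas of two gates this can be found out from their child gates:
    either the two gates match the two sides of an axiom, which can be seen
    within distance two of the gates once it is known which gates have equal
    formulas, or the gates have the same connective, one pair of children is
    related and the other pair, if there is one, has equal formulas.  Equality
    of the formulas of two gates has a similar recursion.  There are
    quadratically many pairs of gates, so that all these facts can be computed
    in polynomial time, although the formulas are exponentially large.

    The recursion is presented as a set of rules ([rules]).  A fact is a
    tag with four arguments, which are positions in the input word or indices
    of gates, hence at most the length [n] of the word.  A circuit is named by
    the position where its code begins, and besides equality and [near] there
    are facts for reading binary numbers and gates, and for checking that all
    gates but the last one are used.  Each tag has a [meaning]; the rules
    are sound for it ([rules_sound]), and every set that is closed under the
    rules contains the accepting fact if the word encodes a related pair
    ([has_accept]).  So the words to be decided are those whose accepting fact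
    is in the least set closed under the rules.

    The rest is a general fact ([PTIME_least_fixpoint]): if membership of an
    address in the next stage is given by a positive existential formula
    with polynomially bounded quantifiers, which may inspect the word and the
    current set of addresses, then membership of address 0 in the least fixed
    point is in PTIME.  The set is kept as a string of bits on one tape, and as
    many rounds of updates are made as there are addresses; a round
    that changes nothing has reached the fixed point, and every other one adds
    an address.  Formulas are evaluated by structured programs whose
    variables are counters in unary, each a tape whose head position is
    the value; each construct multiplies running times by polynomials only.
    The states of the Turing machine of a program are its control points,
    and one step of the program is one step of the machine
    ([exec_runs]). *)

(** * Structured programs for Turing machines *)

Section Programs.
Variable S : finType.

(** Tape 0 carries the input and tape 1 a memory of bits; every other tape is
    a counter, whose value is the position of its head.  Cell 0 of each tape
    carries a mark, and a head on the mark does not move left. *)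
Inductive instr : Type := Nop | GoRight of nat | GoLeft of nat | SetBit.

(** [AtMark i] holds if the head of tape [i] is on its mark.  [Scan P] applies
    [P] to the scanned letter of the input, or to [None] beyond its end, and
    [BitSet] reads the scanned bit of the memory; both fail on the mark. *)
Inductive test : Type :=
| AtMark of nat
| Scan of pred (option S)
| BitSet
| TNot of test
| TAnd of test & test.

(** Structured programs, which are built so that one step of a program is one
    step of a machine. *)
Inductive com : Type :=
| Act of instr
| Seq of com & com
| If of test & com & com
| While of test & com.

(** The positions of the heads and the contents of the memory.  Because of the
    marks, letter [p] of the input and bit [p] of the memory are in cell
    [p.+1]. *)
Definition store : Type := ((nat -> nat) * (nat -> bool))%type.

(** The function [f] with its value at [i] changed to [x]. *)
Definition upd (A : Type) (f : nat -> A) (i : nat) (x : A) : nat -> A :=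
  fun j => if j == i then x else f j.

Definition run_instr (a : instr) (s : store) : store :=
  match a with
  | Nop => s
  | GoRight i => (upd s.1 i (s.1 i).+1, s.2)
  | GoLeft i => (upd s.1 i (s.1 i).-1, s.2)
  | SetBit => (s.1, if s.1 1 is p.+1 then upd s.2 p true else s.2)
  end.

Fixpoint run_test (w : seq S) (b : test) (s : store) : bool :=
  match b with
  | AtMark i => s.1 i == 0
  | Scan P => if s.1 0 is p.+1 then P (onth w p) else false
  | BitSet => if s.1 1 is p.+1 then s.2 p else false
  | TNot b1 => ~~ run_test w b1 s
  | TAnd b1 b2 => run_test w b1 s && run_test w b2 s
  end.

(** [exec w c s t s']: on input [w], the program [c] leads from the store [s] to
    the store [s'] in exactly [t] steps.  Each evaluation of a test takes a
    step. *)
Inductive exec (w : seq S) : com -> store -> nat -> store -> Prop :=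
| exec_act a s : exec w (Act a) s 1 (run_instr a s)
| exec_seq c1 c2 s1 t1 s2 t2 s3 :
    exec w c1 s1 t1 s2 -> exec w c2 s2 t2 s3 ->
    exec w (Seq c1 c2) s1 (t1 + t2) s3
| exec_if b c1 c2 s t s' :
    exec w (if run_test w b s then c1 else c2) s t s' ->
    exec w (If b c1 c2) s t.+1 s'
| exec_while_stop b c s :
    ~~ run_test w b s -> exec w (While b c) s 1 s
| exec_while_loop b c s1 t1 s2 t2 s3 :
    run_test w b s1 -> exec w c s1 t1 s2 -> exec w (While b c) s2 t2 s3 ->
    exec w (While b c) s1 (t1 + t2).+1 s3.

Definition instr_tape (a : instr) : nat :=
  match a with GoRight i | GoLeft i => i | Nop => 0 | SetBit => 1 end.

Fixpoint test_tape (b : test) : nat :=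
  match b with
  | AtMark i => i
  | TNot b1 => test_tape b1
  | TAnd b1 b2 => maxn (test_tape b1) (test_tape b2)
  | _ => 1
  end.

(** The largest number of a tape on which a program may depend. *)
Fixpoint com_tape (c : com) : nat :=
  match c with
  | Act a => instr_tape a
  | Seq c1 c2 => maxn (com_tape c1) (com_tape c2)
  | If b c1 c2 => maxn (test_tape b) (maxn (com_tape c1) (com_tape c2))
  | While b c1 => maxn (test_tape b) (com_tape c1)
  end.

Section Compile.
Variable K : nat.

Local Notation sym := (option (S + bool)).
Local Notation reads := {ffun 'I_K.+1 -> sym}.
Local Notation acts := {ffun 'I_K.+1 -> sym * move}.
Local Notation mark := (Some (inr true) : sym).
Local Notation bit := (Some (inr false) : sym).

(** In the tape alphabet, [inr true] is the mark and [inr false] a bit of the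
    memory that is set; a bit that is not set is a blank. *)
Definition tm_act (a : instr) (r : reads) : acts := [ffun i =>
  match a with
  | Nop => (r i, Stay)
  | GoRight j => (r i, if i == j :> nat then MoveR else Stay)
  | GoLeft j =>
      (r i, if (i == j :> nat) && (r i != mark) then MoveL else Stay)
  | SetBit => (if (i == 1 :> nat) && (r i != mark) then bit else r i, Stay)
  end].

Fixpoint tm_test (b : test) (r : reads) : bool :=
  match b with
  | AtMark i => r (inord i) == mark
  | Scan P => match r ord0 with
      | Some (inl x) => P (Some x) | Some (inr _) => false | None => P None
      end
  | BitSet => r (inord 1) == bit
  | TNot b1 => ~~ tm_test b1 r
  | TAnd b1 b2 => tm_test b1 r && tm_test b2 r
  end.

(** The control points of a program, by recursion on it.  In conditionals and
    loops, [None] is the point where the test is evaluated. *)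
Fixpoint point (c : com) : finType :=
  match c with
  | Act _ => unit
  | Seq c1 c2 => (point c1 + point c2)%type
  | If _ c1 c2 => option (point c1 + point c2)%type
  | While _ c1 => option (point c1)
  end.

Fixpoint entry (c : com) : point c :=
  match c with
  | Act _ => tt
  | Seq c1 c2 => inl (entry c1)
  | If _ _ _ => None
  | While _ _ => None
  end.

(** One step from a control point; the next point is [None] when the program
    has ended. *)
Fixpoint trans (c : com) : point c -> reads -> acts * option (point c) :=
  match c return point c -> reads -> acts * option (point c) with
  | Act a => fun _ r => (tm_act a r, None)
  | Seq c1 c2 => fun q r =>
      match q with
      | inl q1 => let: (a, q') := trans q1 r in
          (a, Some (if q' is Some q1' then inl q1' else inr (entry c2)))
      | inr q2 => let: (a, q') := trans q2 r in (a, omap inr q')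
      end
  | If b c1 c2 => fun q r =>
      match q with
      | None => (tm_act Nop r,
          Some (Some (if tm_test b r then inl (entry c1) else inr (entry c2))))
      | Some (inl q1) =>
          let: (a, q') := trans q1 r in (a, omap (fun x => Some (inl x)) q')
      | Some (inr q2) =>
          let: (a, q') := trans q2 r in (a, omap (fun x => Some (inr x)) q')
      end
  | While b c1 => fun q r =>
      match q with
      | None => (tm_act Nop r,
          if tm_test b r then Some (Some (entry c1)) else None)
      | Some q1 => let: (a, q') := trans q1 r in (a, Some q')
      end
  end.

Local Notation tapes := ('I_K.+1 -> tape (S + bool)).

Definition scan (T : tapes) : reads := [ffun i => tape_head (T i)].

Definition perform (a : acts) (T : tapes) : tapes :=
  fun i => tape_move (a i).2 (tape_write (a i).1 (T i)).

(** [runs q T t T']: started at the point [q] with the tapes [T], the program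
    ends after [t] steps with the tapes [T']. *)
Inductive runs (c : com) : point c -> tapes -> nat -> tapes -> Prop :=
| runs_exit q T a :
    trans q (scan T) = (a, None) -> runs q T 1 (perform a T)
| runs_step q T a q' t T' :
    trans q (scan T) = (a, Some q') -> runs q' (perform a T) t T' ->
    runs q T t.+1 T'.

Lemma runs_seq2 c1 c2 (q : point c2) T t T' :
  runs q T t T' -> @runs (Seq c1 c2) (inr q) T t T'.
Proof.
elim=> [{}q {}T a e|{}q {}T a q' {}t {}T' e _ IH].
  by apply: runs_exit; rewrite /= e.
by apply: runs_step IH; rewrite /= e.
Qed.

Lemma runs_seq1 c1 c2 (q : point c1) T t T' t2 T2 :
  runs q T t T' -> runs (entry c2) T' t2 T2 ->
  @runs (Seq c1 c2) (inl q) T (t + t2) T2.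
Proof.
move=> r1 r2; elim: r1 r2 => [{}q {}T a e|{}q {}T a q' {}t {}T' e _ IH] r2.
  apply: (@runs_step (Seq _ c2) _ _ a (inr (entry c2))) (runs_seq2 _ r2).
  by rewrite /= e.
by rewrite addSn; apply: runs_step (IH r2); rewrite /= e.
Qed.

Lemma runs_if1 b c1 c2 (q : point c1) T t T' :
  runs q T t T' -> @runs (If b c1 c2) (Some (inl q)) T t T'.
Proof.
elim=> [{}q {}T a e|{}q {}T a q' {}t {}T' e _ IH].
  by apply: runs_exit; rewrite /= e.
by apply: runs_step IH; rewrite /= e.
Qed.

Lemma runs_if2 b c1 c2 (q : point c2) T t T' :
  runs q T t T' -> @runs (If b c1 c2) (Some (inr q)) T t T'.
Proof.
elim=> [{}q {}T a e|{}q {}T a q' {}t {}T' e _ IH].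
  by apply: runs_exit; rewrite /= e.
by apply: runs_step IH; rewrite /= e.
Qed.

Lemma runs_while b c (q : point c) T t T' t2 T2 :
  runs q T t T' -> @runs (While b c) None T' t2 T2 ->
  @runs (While b c) (Some q) T (t + t2) T2.
Proof.
move=> r1 r2; elim: r1 r2 => [{}q {}T a e|{}q {}T a q' {}t {}T' e _ IH] r2.
  by apply: (@runs_step (While b c) _ _ a None) r2; rewrite /= e.
by rewrite addSn; apply: runs_step (IH r2); rewrite /= e.
Qed.

(** ** Stores represented by tapes *)

(** The head of [T] is on cell [p], and cell [i] contains [f i].  Cells to the
    left of cell 0 are arbitrary, because they are never visited. *)
Definition tape_at (f : nat -> sym) (p : nat) (T : tape (S + bool)) : Prop :=
  [/\ tape_head T = f p,
      forall j, nth None (tape_right T) j = f (p + j.+1)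
    & forall j, j < p -> nth None (tape_left T) j = f (p - j.+1)].

(** The contents of cell [p] of tape [i], for the input [w] and the memory
    [M]. *)
Definition contents (w : seq S) (M : nat -> bool) (i p : nat) : sym :=
  if p is p'.+1 then
    match i with
    | 0 => omap inl (onth w p')
    | 1 => if M p' then bit else None
    | _ => None
    end
  else mark.

(** The tapes [T] represent the store [s]. *)
Definition represents (w : seq S) (s : store) (T : tapes) : Prop :=
  forall i : 'I_K.+1, tape_at (contents w s.2 i) (s.1 i) (T i).

Lemma tape_at_id f p T : tape_at f p T ->
  tape_at f p (tape_move Stay (tape_write (tape_head T) T)).
Proof. by case: T. Qed.

Lemma tape_at_right f p T : tape_at f p T ->
  tape_at f p.+1 (tape_move MoveR (tape_write (tape_head T) T)).
Proof.
case: T => l h r [/= eh er el]; split=> /=.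
- by have := er 0; rewrite addn1 nth0.
- by move=> j; rewrite nth_behead er addSnnS.
- case=> [|j] lt_jp; first by rewrite subn1.
  by rewrite subSS; apply: el.
Qed.

Lemma tape_at_left f p T : tape_at f p.+1 T ->
  tape_at f p (tape_move MoveL (tape_write (tape_head T) T)).
Proof.
case: T => l h r [/= eh er el]; split=> /=.
- by have := el 0 isT; rewrite subn1 nth0.
- case=> [|j]; first by rewrite addn1.
  by rewrite /= er addSnnS.
- by move=> j lt_jp; rewrite nth_behead el.
Qed.

Lemma tape_at_write f p T x : tape_at f p T ->
  tape_at (upd f p x) p (tape_move Stay (tape_write x T)).
Proof.
case: T => l h r [/= eh er el]; split=> /=.
- by rewrite /upd eqxx.
- by move=> j; rewrite er /upd; case: eqP => //; lia.
- by move=> j lt_jp; rewrite el // /upd; case: eqP => //; lia.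
Qed.

Lemma tape_at_ext f g p T : f =1 g -> tape_at f p T -> tape_at g p T.
Proof.
by move=> efg [h r l]; split=> *; rewrite -efg; [exact: h|exact: r|exact: l].
Qed.

Lemma contents_mark w M i p : (contents w M i p == mark) = (p == 0).
Proof.
case: p i => [|p] [|[|i]] //=; last by case: (M p).
by case: (onth w p).
Qed.

Lemma represents_act w s T a : instr_tape a <= K -> represents w s T ->
  represents w (run_instr a s) (perform (tm_act a (scan T)) T).
Proof.
case: s => pos M /= leK rep i; have := rep i; rewrite /perform !ffunE /=.
have [/= hi _ _] := rep i.
case: a leK => [|j|j|] /= leK at_i.
- exact: tape_at_id.
- rewrite /upd; case: eqP => [<-|_]; first exact: tape_at_right.
  exact: tape_at_id.
- rewrite /upd hi /= contents_mark; case: (eqVneq (i : nat) j) => [<-|_] /=.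
    rewrite -hi; case: (posnP (pos i)) => [p0|p_gt0].
      by rewrite p0 /= -{1}p0; exact: tape_at_id.
    by apply: tape_at_left; rewrite prednK.
  by rewrite -hi; exact: tape_at_id.
- rewrite hi /= contents_mark; case: (eqVneq (i : nat) 1) => [i1|ni1] /=; last first.
    rewrite -hi; apply: tape_at_id; apply: tape_at_ext at_i => -[|p] //=.
    by case: (i : nat) ni1 => [|[|k]].
  rewrite -i1; move: hi at_i; case: (pos i) => [|p] /= hi at_i.
    by rewrite -hi; apply: tape_at_id.
  apply: tape_at_ext (tape_at_write bit at_i) => -[|p']; rewrite /upd i1 //=.
  by rewrite eqSS; case: eqP.
Qed.

Lemma represents_test w s T b : test_tape b <= K -> represents w s T ->
  tm_test b (scan T) = run_test w b s.
Proof.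
case: s => pos M /= + rep; elim: b => [j|P||b IH|b1 IH1 b2 IH2] /= leK.
- by have [hi _ _] := rep (inord j); rewrite ffunE hi contents_mark /= inordK.
- have [hi _ _] := rep ord0; rewrite ffunE hi /=.
  by case: (pos 0) => //= p; case: (onth w p).
- have [hi _ _] := rep (inord 1); rewrite ffunE hi /= inordK //.
  by case: (pos 1) => //= p; case: (M p).
- by rewrite IH.
- by rewrite IH1 ?IH2 //; apply: leq_trans leK; rewrite ?leq_maxl ?leq_maxr.
Qed.

(** The machine simulates a program in real time. *)
Theorem exec_runs w c s t s' T :
  com_tape c <= K -> exec w c s t s' -> represents w s T ->
  exists2 T', runs (entry c) T t T' & represents w s' T'.
Proof.
move=> leK ex; elim: ex leK T => {c s t s'}.
- move=> a s /= leK T rep; exists (perform (tm_act a (scan T)) T).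
    exact: runs_exit.
  exact: represents_act.
- move=> c1 c2 s1 t1 s2 t2 s3 _ IH1 _ IH2 /=; rewrite geq_max => /andP[le1 le2].
  move=> T /(IH1 le1)[T1 r1] /(IH2 le2)[T2 r2 rep2]; exists T2 => //.
  exact: runs_seq1 r1 r2.
- move=> b c1 c2 s t s' _ IH /=; rewrite !geq_max => /and3P[leb le1 le2] T rep.
  have repN : represents w s (perform (tm_act Nop (scan T)) T).
    exact: (@represents_act w s T Nop).
  have et := represents_test leb rep.
  case: (run_test w b s) et IH => et IH.
    have [T' r rep'] := IH le1 _ repN; exists T' => //.
    by apply: runs_step (runs_if1 _ _ r); rewrite /= et.
  have [T' r rep'] := IH le2 _ repN; exists T' => //.
  by apply: runs_step (runs_if2 _ _ r); rewrite /= et.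
- move=> b c s /negbTE nb /=; rewrite geq_max => /andP[leb le1] T rep.
  exists (perform (tm_act Nop (scan T)) T).
    by apply: runs_exit; rewrite /= (represents_test leb rep) nb.
  exact: (@represents_act w s T Nop).
- move=> b c s1 t1 s2 t2 s3 b1 _ IH1 _ IH2 leK T rep.
  have := leK; rewrite /= geq_max => /andP[leb le1].
  have repN : represents w s1 (perform (tm_act Nop (scan T)) T).
    exact: (@represents_act w s1 T Nop).
  have [T1 r1 rep1] := IH1 le1 _ repN.
  have [T2 r2 rep2] := IH2 leK _ rep1; exists T2 => //.
  by apply: runs_step (runs_while r1 r2); rewrite /= (represents_test leb rep) b1.
Qed.

End Compile.
End Programs.

(** * The Turing machine of a program *)

Section Machine.
Variables (S : finType) (c : com S) (b : test S).

Let K := maxn 1 (maxn (com_tape c) (test_tape b)).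

Local Notation sym := (option (S + bool)).
Local Notation reads := {ffun 'I_K.+1 -> sym}.
Local Notation acts := {ffun 'I_K.+1 -> sym * move}.

(** Besides the control points of [c] there are two states in which the marks
    are put in place ([inr (inl _)]), one in which [c] has ended and the test [b] is
    to be evaluated ([inr (inr None)]), and the final states. *)
Definition machine_state : finType :=
  (point c + (bool + option bool))%type.

(** Cell 0 of the tape of the input is the cell to the left of its first letter,
    so that the first step moves that head to the left. *)
Definition machine_trans (q : machine_state) (r : reads) :
    machine_state * acts :=
  match q with
  | inl q1 => let: (a, q') := trans q1 r in
      (if q' is Some q2 then inl q2 else inr (inr None), a)
  | inr (inl false) => (inr (inl true),
      [ffun i => (r i, if i == ord0 then MoveL else Stay)])
  | inr (inl true) => (inl (entry c), [ffun i => (Some (inr true), Stay)])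
  | inr (inr _) => (inr (inr (Some (tm_test b r))), tm_act (Nop) r)
  end.

Definition machine : TM S :=
  @MkTM S K bool machine_state (inr (inl false))
    (fun q => if q is inr (inr (Some a)) then Some a else None)
    machine_trans.

Lemma runs_machine q T t T' : @runs S K c q T t T' ->
  iter t (@step S machine) (inl q, T) = (inr (inr None), T').
Proof.
elim=> [{}q {}T a e|{}q {}T a q' {}t {}T' e _ IH]; rewrite ?iterSr /=.
  by rewrite -/(scan T) e.
by rewrite -/(scan T) e.
Qed.

(** All heads are on the marks and no bit is set. *)
Definition blank_store : store := (fun=> 0, fun=> false).

Lemma machine_setup w :
  exists2 T, iter 2 (@step S machine) (init machine w) = (inl (entry c), T)
    & @represents S K w blank_store T.
Proof.
eexists; first by rewrite /= /init; reflexivity.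
move=> i /=; rewrite !ffunE /=; case: i => -[|i] lti /=.
  split=> //= j; case: w => [|x w] /=; first by case: j => [|j] //=; rewrite nth_nil.
  elim: w x j => [|y w IH] x [|j] //=.
  by case: j.
split=> //= j; rewrite nth_nil; case: i lti => //.
Qed.

Lemma step_final n q T a : tm_final (t := machine) q = Some a ->
  iter n (@step S machine) (q, T) = (q, T).
Proof. by move=> ea; elim: n => //= n ->; rewrite /step ea. Qed.

(** A problem is in PTIME if it is decided by a program, with the test [b] giving
    the answer, in time polynomial in the length of the word. *)
Lemma PTIME_program (L : seq S -> Prop) (k : nat) :
  (forall w, exists t s, [/\ exec w c blank_store t s,
     t <= (size w).+2 ^ k & run_test w b s <-> L w]) ->
  PTIME L.
Proof.
move=> cP; exists machine, (('X + 2%:P) ^+ k + 3%:P)%R => w.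
have [t [s [ex le_t Ls]]] := cP w.
exists (run_test w b s); split=> //.
have [T0 e0 rep0] := machine_setup w.
have [|T1 r1 rep1] := @exec_runs S K w c _ _ _ T0 _ ex rep0.
  by rewrite /K !leq_max leqnn orbT.
have e1 := runs_machine r1.
rewrite /answer_after.
have -> : (('X + 2%:P) ^+ k + 3%:P).[size w]%R = (size w).+2 ^ k + 3.
  rewrite hornerD horner_exp hornerD hornerX !hornerC -[(size w).+2]addn2.
  by rewrite !natrXE.
(* Two steps write the marks, [t] steps run the program and one evaluates the
   test; thereafter the configuration is final. *)
rewrite -(subnK le_t) -addnA.
rewrite iterD (_ : t + 3 = 1 + t + 2); last by lia.
rewrite 2!iterD e0 e1 /= -/(scan T1).
rewrite (@represents_test S K w s) //; last by rewrite /K !leq_max leqnn !orbT.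
by rewrite (step_final _ _ (a := run_test w b s)).
Qed.

End Machine.

(** * Expressions and positive formulas *)

(** Equality of functions that are updated at finitely many arguments. *)
Ltac funeq := apply: functional_extensionality => ?;
  rewrite /= /upd /=; repeat case: eqP => ?; subst; try lia.

Section Formulas.
Variable S : finType.

(** Arithmetical expressions.  [EVar k] is entry [k] of the environment, counted
    from its beginning (a de Bruijn level), and [ELen] the length of the
    word. *)
Inductive expr : Type :=
| EVar of nat
| ECst of nat
| ELen
| EAdd of expr & expr
| EMul of expr & expr.

(** Positive formulas about a word and a set of addresses.  [FScan P a] applies
    [P] to letter [a] of the word, or to [None] if there is none; [FBit a] says
    that the address [a] is in the set; [FEx a f] quantifies over the numbers
    less than [a], and its variable is appended to the environment. *)
Inductive form : Type :=
| FLe of expr & expr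
| FScan of pred (option S) & expr
| FBit of expr
| FAnd of form & form
| FOr of form & form
| FEx of expr & form.

Fixpoint eval (n : nat) (e : seq nat) (a : expr) : nat :=
  match a with
  | EVar k => nth 0 e k
  | ECst c => c
  | ELen => n
  | EAdd a1 a2 => eval n e a1 + eval n e a2
  | EMul a1 a2 => eval n e a1 * eval n e a2
  end.

(** Truth of a formula for a set of addresses that is given by its
    characteristic function; [sat] is the same for an arbitrary set. *)
Fixpoint satb (w : seq S) (M : nat -> bool) (e : seq nat) (f : form) : bool :=
  match f with
  | FLe a1 a2 => eval (size w) e a1 <= eval (size w) e a2
  | FScan P a => P (onth w (eval (size w) e a))
  | FBit a => M (eval (size w) e a)
  | FAnd f1 f2 => satb w M e f1 && satb w M e f2
  | FOr f1 f2 => satb w M e f1 || satb w M e f2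
  | FEx a f1 =>
      has (fun x => satb w M (rcons e x) f1) (iota 0 (eval (size w) e a))
  end.

Fixpoint sat (w : seq S) (X : nat -> Prop) (e : seq nat) (f : form) : Prop :=
  match f with
  | FLe a1 a2 => eval (size w) e a1 <= eval (size w) e a2
  | FScan P a => P (onth w (eval (size w) e a))
  | FBit a => X (eval (size w) e a)
  | FAnd f1 f2 => sat w X e f1 /\ sat w X e f2
  | FOr f1 f2 => sat w X e f1 \/ sat w X e f2
  | FEx a f1 => exists2 x, x < eval (size w) e a & sat w X (rcons e x) f1
  end.

Lemma satP w (M : nat -> bool) e f : reflect (sat w M e f) (satb w M e f).
Proof.
elim: f e => [a1 a2|P a|a|f1 IH1 f2 IH2|f1 IH1 f2 IH2|a f1 IH] e /=;
  try exact: idP.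
- by apply: (iffP andP) => -[/IH1 ? /IH2 ?].
- by apply: (iffP orP) => -[/IH1 ?|/IH2 ?]; [left|right|left|right].
- apply: (iffP hasP) => [[x]|[x]].
    by rewrite mem_iota => lt_x /IH ?; exists x.
  by exists x; [rewrite mem_iota | apply/IH].
Qed.

Lemma sat_mono w (X Y : nat -> Prop) e f :
  (forall a, X a -> Y a) -> sat w X e f -> sat w Y e f.
Proof.
move=> XY; elim: f e => [a1 a2|P a|a|f1 IH1 f2 IH2|f1 IH1 f2 IH2|a f1 IH] e //=.
- exact: XY.
- by case=> /IH1 ? /IH2.
- by case=> [/IH1|/IH2] ?; [left|right].
- by case=> x lt_x /IH ?; exists x.
Qed.

(** ** Time bounds *)

(** The program [c] leads from [s] to [s'] in at most [T] steps. *)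
Definition exec_within (w : seq S) (c : com S) (s : store) (T : nat)
    (s' : store) : Prop :=
  exists2 t, t <= T & exec w c s t s'.

Lemma within_le w c s T1 T2 s' :
  T1 <= T2 -> exec_within w c s T1 s' -> exec_within w c s T2 s'.
Proof. by move=> le12 [t le1 ex]; exists t => //; apply: leq_trans le12. Qed.

Lemma within_act w a s : exec_within w (Act S a) s 1 (run_instr a s).
Proof. by exists 1 => //; constructor. Qed.

Lemma within_seq w c1 c2 s1 T1 s2 T2 s3 :
  exec_within w c1 s1 T1 s2 -> exec_within w c2 s2 T2 s3 ->
  exec_within w (Seq c1 c2) s1 (T1 + T2) s3.
Proof.
move=> [t1 le1 ex1] [t2 le2 ex2]; exists (t1 + t2); first exact: leq_add.
by constructor 2 with s2.
Qed.

Lemma within_if w b c1 c2 s T s' :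
  exec_within w (if run_test w b s then c1 else c2) s T s' ->
  exec_within w (If b c1 c2) s T.+1 s'.
Proof. by case=> t le_t ex; exists t.+1 => //; constructor. Qed.

(** A loop that passes through the stores [f n], ..., [f 0]. *)
Lemma within_count w b c (f : nat -> store) T n :
  (forall k, k < n -> exec_within w c (f k.+1) T (f k)) ->
  (forall k, k <= n -> run_test w b (f k) = (0 < k)) ->
  exec_within w (While b c) (f n) (n * T.+1).+1 (f 0).
Proof.
elim: n => [|n IH] body guard.
  by exists 1 => //; constructor; rewrite guard.
have [||t2 le2 ex2] := IH; first by move=> k lt_k; apply: body; lia.
  by move=> k le_k; apply: guard; lia.
have [t1 le1 ex1] := body n (ltnSn n); exists (t1 + t2).+1.
  by rewrite mulSn; lia.
by apply: exec_while_loop ex1 ex2; rewrite guard.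
Qed.

(** ** Counters *)

(** Counter [i] is not 0. *)
Definition busy (i : nat) : test S := TNot (AtMark S i).

(** Set counter [i] to 0. *)
Definition clear (i : nat) : com S := While (busy i) (Act S (GoLeft i)).

(** Add counter [i] to counter [j], and set it to 0. *)
Definition pour (i j : nat) : com S :=
  While (busy i) (Seq (Act S (GoLeft i)) (Act S (GoRight j))).

(** Add counter [i] to counter [j] without changing it; counter [k] is used as
    an intermediate store and has to be 0. *)
Definition copy (i j k : nat) : com S :=
  Seq (While (busy i) (Seq (Act S (GoLeft i))
         (Seq (Act S (GoRight j)) (Act S (GoRight k)))))
      (pour k i).

Lemma within_clear w i p M :
  exec_within w (clear i) (p, M) (p i * 2).+1 (upd p i 0, M).
Proof.
have e : p = upd p i (p i) by funeq.
rewrite {1}e; apply: (within_count (f := fun k => (upd p i k, M))) => k lek /=.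
  have -> : (upd p i k, M) = run_instr (GoLeft i) (upd p i k.+1, M).
    by congr pair; funeq.
  exact: within_act.
by rewrite /upd eqxx lt0n.
Qed.

Lemma within_pour w i j p M : i != j ->
  exec_within w (pour i j) (p, M) (p i * 3).+1
    (upd (upd p j (p j + p i)) i 0, M).
Proof.
move=> /eqP ne.
have e : p = upd (upd p j (p j + (p i - p i))) i (p i) by funeq.
rewrite {1}e.
have -> : upd (upd p j (p j + p i)) i 0 = upd (upd p j (p j + (p i - 0))) i 0.
  by rewrite subn0.
apply: (within_count (f := fun k => (upd (upd p j (p j + (p i - k))) i k, M))).
  move=> k lek.
  have -> : (upd (upd p j (p j + (p i - k))) i k, M) =
      run_instr (GoRight j) (run_instr (GoLeft i)
        (upd (upd p j (p j + (p i - k.+1))) i k.+1, M)).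
    by congr pair; funeq.
  by apply: (@within_seq _ _ _ _ 1 _ 1); apply: within_act.
by move=> k lek /=; rewrite /upd eqxx lt0n.
Qed.

Lemma within_copy w i j k p M : i != j -> i != k -> j != k -> p k = 0 ->
  exec_within w (copy i j k) (p, M) (p i * 7).+2 (upd p j (p j + p i), M).
Proof.
move=> /eqP nij /eqP nik /eqP njk pk.
(* The store when [l] steps of the first loop are left. *)
pose f l := (upd (upd (upd p k (p i - l)) j (p j + (p i - l))) i l, M) : store.
have e : (p, M) = f (p i) by congr pair; funeq.
rewrite {1}e; apply: (@within_le _ _ _ ((p i * 4).+1 + ((f 0).1 k * 3).+1)).
  by rewrite /f /= /upd; repeat case: eqP => //; lia.
apply: within_seq (within_count (f := f) (T := 3) _ _) _.
- move=> l lt_l.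
  have -> : f l = run_instr (GoRight k) (run_instr (GoRight j)
                   (run_instr (GoLeft i) (f l.+1))).
    by congr pair; funeq.
  apply: (@within_seq _ _ _ _ 1 _ 2); first exact: within_act.
  by apply: (@within_seq _ _ _ _ 1 _ 1); apply: within_act.
- by move=> l lel /=; rewrite /upd eqxx lt0n.
- have nki : k != i by apply/eqP => eki; apply: nik.
  have := @within_pour w k i (f 0).1 M nki.
  congr (exec_within _ _ _ _ (_, _)); rewrite /f /=; funeq.
Qed.

(** ** Access to the cell of tape [i] named by counter [j] *)

(** Perform [c] with the head of tape [i] on cell [v.+1], where [v] is the value
    of counter [j].  Counter [j] is 0 when [c] starts and may be changed by [c],
    and counter [j.+1], which has to be 0, keeps [v] for the way back. *)
Definition visit (i j : nat) (c : com S) : com S :=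
  Seq (Act S (GoRight i))
  (Seq (While (busy j) (Seq (Act S (GoLeft j))
         (Seq (Act S (GoRight i)) (Act S (GoRight j.+1)))))
  (Seq c
  (Seq (While (busy j.+1) (Seq (Act S (GoLeft j.+1)) (Act S (GoLeft i))))
       (Act S (GoLeft i))))).

Lemma within_visit w i j c p M x M' T : i < j -> p i = 0 -> p j.+1 = 0 ->
  (forall q, q i = (p j).+1 -> q j = 0 ->
     exec_within w c (q, M) T (upd q j x, M')) ->
  exec_within w (visit i j c) (p, M) (p j * 7 + T + 4) (upd p j x, M').
Proof.
move=> ltij pi pj1 cP; set v := p j in cP *.
(* The stores on the way to the cell and on the way back, with [l] steps
   left. *)
pose f l := (upd (upd (upd p i (v - l).+1) j l) j.+1 (v - l), M) : store.
pose g l := (upd (upd (upd p i l.+1) j x) j.+1 l, M') : store.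
apply: (@within_le _ _ _ (1 + ((v * 4).+1 + (T + ((v * 3).+1 + 1))))).
  by lia.
apply: within_seq (within_act _ _ _) _.
have -> : run_instr (GoRight i) (p, M) = f v by congr pair; rewrite /v; funeq.
apply: within_seq (within_count (f := f) (T := 3) _ _) _.
- move=> l lt_l.
  have -> : f l = run_instr (GoRight j.+1) (run_instr (GoRight i)
                   (run_instr (GoLeft j) (f l.+1))).
    by congr pair; funeq.
  apply: (@within_seq _ _ _ _ 1 _ 2); first exact: within_act.
  by apply: (@within_seq _ _ _ _ 1 _ 1); apply: within_act.
- by move=> l lel; rewrite /= /upd eqxx lt0n (ltn_eqF (ltnSn j)).
apply: within_seq (_ : exec_within _ _ _ _ (g v)) _.
  have -> : g v = (upd (f 0).1 j x, M') by congr pair; funeq.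
  by apply: cP; rewrite /f /upd /=; repeat case: eqP => //; lia.
apply: within_seq (within_count (f := g) (T := 2) _ _) _.
- move=> l lt_l.
  have -> : g l = run_instr (GoLeft i) (run_instr (GoLeft j.+1) (g l.+1)).
    by congr pair; funeq.
  by apply: (@within_seq _ _ _ _ 1 _ 1); apply: within_act.
- by move=> l lel /=; rewrite /upd eqxx lt0n.
have -> : (upd p j x, M') = run_instr (GoLeft i) (g 0).
  by congr pair; funeq.
exact: within_act.
Qed.

End Formulas.

(** * Powers as time bounds *)

(** Running times and values are bounded by powers of a number [X] that is
    greater than 1 and bounds the length of the word and the entries of the
    environment.  Such bounds are closed under sums and products. *)
Lemma pow_add X i j a b :
  1 < X -> a <= X ^ i -> b <= X ^ j -> a + b <= X ^ (i + j).+1.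
Proof.
move=> X2 lea leb; rewrite expnS.
apply: leq_trans (_ : 2 * X ^ (i + j) <= _); last by rewrite leq_mul2r X2 orbT.
rewrite mul2n -addnn leq_add //.
  by apply: leq_trans lea _; rewrite leq_exp2l // leq_addr.
by apply: leq_trans leb _; rewrite leq_exp2l // leq_addl.
Qed.

Lemma pow_mul X i j a b : a <= X ^ i -> b <= X ^ j -> a * b <= X ^ (i + j).
Proof. by move=> lea leb; rewrite expnD leq_mul. Qed.

Lemma pow_cst X c : 1 < X -> c <= X ^ c.
Proof. by move=> X2; apply/ltnW/ltn_expl. Qed.

Lemma pow_succ X i a : 1 < X -> a <= X ^ i -> a.+1 <= X ^ i.+1.
Proof.
by move=> X2 lea; have := pow_add X2 lea (leqnn (X ^ 0)); rewrite addn1 addn0.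
Qed.

Lemma pow_gt1 X i : 1 < X -> 1 < X ^ i.+1.
Proof. by move=> X2; rewrite -(exp1n i.+1) ltn_exp2r. Qed.

Lemma all_pow X i v e : 1 < X -> all (leq^~ X) e -> v <= X ^ i ->
  all (leq^~ (X ^ i.+1)) (e ++ [:: v]).
Proof.
move=> X2 eX lev; rewrite all_cat /= andbT; apply/andP; split.
  apply: sub_all eX => u leu; apply: leq_trans leu _.
  by rewrite -{1}(expn1 X) leq_exp2l.
by apply: leq_trans lev _; rewrite leq_exp2l.
Qed.

Lemma le_pow X i n : 1 < X -> n <= X -> n <= X ^ i.+1.
Proof.
by move=> X2 le; apply: leq_trans le _; rewrite -{1}(expn1 X) leq_exp2l.
Qed.

(** Finds the exponent of a bound that is built from known ones. *)
Ltac pow_bound :=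
  repeat first [eassumption | eapply pow_succ | eapply pow_add
               | eapply pow_mul | (apply: pow_cst; assumption)].

(** * Evaluating expressions *)

(** The positions of the heads when the entries of [e] are stored in the
    counters from 3 onwards, all further counters are 0, counter 2 has
    the value [r], and the heads of tapes 0 and 1 are on the marks. *)
Definition stack (r : nat) (e : seq nat) (i : nat) : nat :=
  match i with 0 | 1 => 0 | 2 => r | i'.+3 => nth 0 e i' end.

(** The counter that stores entry [d + k], that is, the one with index [k] above
    the [d] lowest entries. *)
Definition slot (d k : nat) : nat := (d + k).+3.

Arguments slot : simpl never.
Arguments stack : simpl never.

Section Stack.
Variable S : finType.

Lemma stack_slot r e l k : stack r (e ++ l) (slot (size e) k) = nth 0 l k.
Proof. by rewrite /stack /= nth_cat ltnNge leq_addr addKn. Qed.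

Lemma upd_slot r e l k v :
  upd (stack r (e ++ l)) (slot (size e) k) v = stack r (e ++ set_nth 0 l k v).
Proof.
apply: functional_extensionality => -[|[|[|i]]] //; rewrite /upd /stack /= !eqSS.
rewrite !nth_cat nth_set_nth /=; case: ltnP => [lti|lei].
  by case: eqP => // ei; rewrite ei ltnNge leq_addr in lti.
by rewrite -(subnKC lei) eqn_add2l addKn.
Qed.

Lemma stack_slot0 r e k : stack r e (slot (size e) k) = 0.
Proof. by rewrite -[e in stack r e]cats0 stack_slot nth_nil. Qed.

Lemma upd_slot0 r e v :
  upd (stack r e) (slot (size e) 0) v = stack r (e ++ [:: v]).
Proof. by rewrite -[e in stack r e]cats0 upd_slot. Qed.

Lemma stack_ext r e l l' : nth 0 l =1 nth 0 l' ->
  stack r (e ++ l) = stack r (e ++ l').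
Proof.
move=> ell; apply: functional_extensionality => -[|[|[|i]]] //.
by rewrite /stack !nth_cat ell.
Qed.

Lemma stack_cat0 r e : stack r (e ++ [:: 0]) = stack r e.
Proof.
rewrite -[in RHS](cats0 e); apply: stack_ext => -[|i] //=; exact: nth_nil.
Qed.

Lemma stack_cat10 r e a : stack r (e ++ [:: a; 0]) = stack r (e ++ [:: a]).
Proof. by apply: stack_ext => -[|[|i]] //=; rewrite nth_nil. Qed.

(** The variables of [a] are entries of an environment of length [d]. *)
Fixpoint scoped_expr (d : nat) (a : expr) : bool :=
  match a with
  | EVar k => k < d
  | EAdd a1 a2 | EMul a1 a2 => scoped_expr d a1 && scoped_expr d a2
  | _ => true
  end.

(** The free variables of [f] are entries of an environment of length [d]. *)
Fixpoint scoped (d : nat) (f : form S) : bool :=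
  match f with
  | FLe a1 a2 => scoped_expr d a1 && scoped_expr d a2
  | FScan _ a | FBit a => scoped_expr d a
  | FAnd f1 f2 | FOr f1 f2 => scoped d f1 && scoped d f2
  | FEx a f1 => scoped_expr d a && scoped d.+1 f1
  end.

Lemma eval_cat n e l a :
  scoped_expr (size e) a -> eval n (e ++ l) a = eval n e a.
Proof.
elim: a => //= [k|a1 IH1 a2 IH2|a1 IH1 a2 IH2].
- by move=> ltk; rewrite nth_cat ltk.
- by case/andP=> /IH1 -> /IH2 ->.
- by case/andP=> /IH1 -> /IH2 ->.
Qed.

Lemma scoped_expr_le d d' a : d <= d' -> scoped_expr d a -> scoped_expr d' a.
Proof.
move=> led; elim: a => //= [k|a1 IH1 a2 IH2|a1 IH1 a2 IH2].
- by move=> ltk; apply: leq_trans ltk led.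
- by case/andP=> /IH1 -> /IH2 ->.
- by case/andP=> /IH1 -> /IH2 ->.
Qed.

Fixpoint repeat_act (n : nat) (a : instr) : com S :=
  if n is n'.+1 then Seq (Act S a) (repeat_act n' a) else Act S Nop.

Definition length_code (j : nat) : com S :=
  Seq (Act S (GoRight 0))
  (Seq (While (Scan isSome) (Seq (Act S (GoRight 0)) (Act S (GoRight j))))
       (clear S 0)).

(** Programs that push the value of [a] onto a stack with [d] entries. *)
Fixpoint expr_code (d : nat) (a : expr) : com S :=
  match a with
  | EVar k => copy S k.+3 (slot d 0) (slot d 1)
  | ECst c => repeat_act c (GoRight (slot d 0))
  | ELen => length_code (slot d 0)
  | EAdd a1 a2 =>
      Seq (expr_code d a1) (Seq (expr_code (d + 1) a2)
        (pour S (slot d 1) (slot d 0)))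
  | EMul a1 a2 =>
      Seq (expr_code d a1) (Seq (expr_code (d + 1) a2)
      (Seq (While (busy S (slot d 0)) (Seq (Act S (GoLeft (slot d 0)))
              (copy S (slot d 1) (slot d 2) (slot d 3))))
      (Seq (clear S (slot d 1)) (pour S (slot d 2) (slot d 0)))))
  end.

(** The exponents [kv] of a bound for the value and [kt] of a bound for the
    time do not depend on the word and on the environment. *)
Definition expr_spec (a : expr) (kv kt : nat) : Prop :=
  forall (w : seq S) r e M X, 1 < X -> size w <= X -> all (leq^~ X) e ->
    scoped_expr (size e) a ->
    eval (size w) e a <= X ^ kv /\
    exec_within w (expr_code (size e) a) (stack r e, M) (X ^ kt)
      (stack r (e ++ [:: eval (size w) e a]), M).

Lemma within_repeat w n i p M :
  exec_within w (repeat_act n (GoRight i)) (p, M) n.+1 (upd p i (p i + n), M).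
Proof.
elim: n p => [|n IH] p.
  have -> : upd p i (p i + 0) = p.
    by funeq.
  exact: within_act.
apply: (@within_seq _ _ _ _ _ 1 _ n.+1); first exact: within_act.
have := IH (upd p i (p i).+1); congr (exec_within _ _ _ _ (_, _)).
by funeq.
Qed.

Lemma within_length w j p M : j != 0 -> p 0 = 0 ->
  exec_within w (length_code j) (p, M) (size w * 5 + 5)
    (upd p j (p j + size w), M).
Proof.
move=> /eqP nj p0; pose n := size w.
pose f l := (upd (upd p 0 (n - l).+1) j (p j + (n - l)), M) : store.
apply: (@within_le _ _ _ _ (1 + ((n * 3).+1 + ((n.+1) * 2).+1))).
  by rewrite /n; lia.
apply: within_seq; first exact: within_act.
have -> : run_instr (GoRight 0) (p, M) = f n.
  by congr pair; funeq.
apply: within_seq.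
  apply: (within_count (f := f) (T := 2)) => l lel.
    have -> : f l = run_instr (GoRight j) (run_instr (GoRight 0) (f l.+1)).
      by congr pair; funeq.
    by apply: (@within_seq _ _ _ _ _ 1 _ 1); apply: within_act.
  rewrite /= /upd; case: eqP => [e0|_]; first by case: nj.
  by rewrite eqxx onthTE; lia.
have := within_clear w 0 (f 0).1 M.
congr (exec_within _ _ (_, _) _ (_, _)); rewrite ?subn0 /= /upd.
  by case: eqP => [e0|_]; [case: nj | rewrite eqxx subn0].
apply: functional_extensionality => i.
by rewrite subn0; case: (i =P 0) => [->|//]; case: eqP => // e0; case: nj.
Qed.

Lemma expr_code_ok a : exists kv kt, expr_spec a kv kt.
Proof.
elim: a => [k|c||a1 [kv1 [kt1 IH1]] a2 [kv2 [kt2 IH2]]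
           |a1 [kv1 [kt1 IH1]] a2 [kv2 [kt2 IH2]]].
- exists 1; eexists => w r e M X X2 wX eX /= ltk.
  have le_v : nth 0 e k <= X ^ 1 by rewrite expn1; apply: (allP eX); rewrite mem_nth.
  split=> //; eapply within_le; first last.
    have := @within_copy S w k.+3 (slot (size e) 0) (slot (size e) 1) (stack r e) M.
    rewrite !stack_slot0 add0n upd_slot0.
    by apply; rewrite // /slot; lia.
  by pow_bound.
- exists c, c.+1 => w r e M X X2 wX eX _ /=; split; first exact: pow_cst.
  apply: within_le (pow_succ X2 (pow_cst c X2)) _.
  have := within_repeat w c (slot (size e) 0) (stack r e) M.
  by rewrite stack_slot0 upd_slot0.
- exists 1; eexists => w r e M X X2 wX eX _ /=.
  have le_v : size w <= X ^ 1 by rewrite expn1.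
  split=> //; eapply within_le; first last.
    have := @within_length w (slot (size e) 0) (stack r e) M.
    by rewrite stack_slot0 upd_slot0; apply.
  by pow_bound.
- eexists; eexists => w r e M X X2 wX eX /= /andP[s1 s2].
  have [v1X t1X] := IH1 w r e M X X2 wX eX s1.
  set v1 := eval (size w) e a1 in v1X t1X *.
  have := IH2 w r (e ++ [:: v1]) M _ (pow_gt1 _ X2) (le_pow _ X2 wX) (all_pow X2 eX v1X).
  rewrite size_cat /= (scoped_expr_le _ s2) ?leq_addr // => /(_ isT).
  rewrite -!expnM (eval_cat _ _ s2) => -[v2X t2X].
  set v2 := eval (size w) e a2 in v2X t2X *; split; first by pow_bound.
  eapply within_le; first last.
    apply: within_seq t1X (within_seq t2X _); rewrite -catA /=.
    have := @within_pour S w (slot (size e) 1) (slot (size e) 0)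
      (stack r (e ++ [:: v1; v2])) M.
    by rewrite !stack_slot !upd_slot /= stack_cat10; apply; rewrite /slot; lia.
  by pow_bound.
- eexists; eexists => w r e M X X2 wX eX /= /andP[s1 s2].
  have [v1X t1X] := IH1 w r e M X X2 wX eX s1.
  set v1 := eval (size w) e a1 in v1X t1X *.
  have := IH2 w r (e ++ [:: v1]) M _ (pow_gt1 _ X2) (le_pow _ X2 wX) (all_pow X2 eX v1X).
  rewrite size_cat /= (scoped_expr_le _ s2) ?leq_addr // => /(_ isT).
  rewrite -!expnM (eval_cat _ _ s2) => -[v2X t2X].
  set v2 := eval (size w) e a2 in v2X t2X *; split; first by pow_bound.
  eapply within_le; first last.
    apply: within_seq t1X (within_seq t2X _); rewrite -catA /=.
    (* The product is accumulated by adding [v2] for each unit of [v1]. *)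
    pose f l : store := (stack r (e ++ [:: l; v2; (v1 - l) * v2]), M).
    have -> : (stack r (e ++ [:: v1; v2]), M) = f v1.
      by congr pair; apply: stack_ext => -[|[|[|i]]] //=; rewrite ?subnn ?nth_nil.
    apply: within_seq (within_count (f := f) (T := (v2 * 7).+3) _ _) _.
    - move=> l lel.
      apply: (@within_seq _ _ _ _ _ 1
        (stack r (e ++ [:: l; v2; (v1 - l.+1) * v2]), M) (v2 * 7).+2).
        have := within_act w (GoLeft (slot (size e) 0)) (f l.+1).
        by rewrite /f /= stack_slot upd_slot.
      have := @within_copy S w (slot (size e) 1) (slot (size e) 2) (slot (size e) 3)
        (stack r (e ++ [:: l; v2; (v1 - l.+1) * v2])) M.
      rewrite !stack_slot !upd_slot /f /= (_ : _ + v2 = (v1 - l) * v2); last first.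
        by rewrite -(subnSK lel) mulSn addnC.
      by apply; rewrite /slot; lia.
    - by move=> l lel; rewrite /busy /= stack_slot lt0n.
    rewrite /f subn0; apply: within_seq (within_clear _ _ _ _) _.
    rewrite upd_slot /=.
    have := @within_pour S w (slot (size e) 2) (slot (size e) 0)
      (stack r (e ++ [:: 0; 0; v1 * v2])) M.
    rewrite !stack_slot !upd_slot /= add0n => /(_ _)/wrap[]; first by rewrite /slot; lia.
    congr (exec_within _ _ _ _ (_, _)).
    by apply: stack_ext => -[|[|[|i]]] //=; rewrite nth_nil.
  by rewrite stack_slot /=; pow_bound.
Qed.

End Stack.

(** * Evaluating formulas *)

Section FormCode.
Variable S : finType.

(** Programs that push the truth value of [f], as 0 or 1, onto a stack with [d]
    entries.  Conjunctions and disjunctions evaluate their second member only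
    if necessary, in the place of the first, so that the variables of
    quantifiers are always at the level of their depth.  The loop for [FEx]
    counts the bound down, and what is left of it is the value of the
    variable; it stops at the first value for which [f1] holds. *)
Fixpoint form_code (d : nat) (f : form S) : com S :=
  let i := slot d 0 in
  match f with
  | FLe a1 a2 =>
      Seq (expr_code S d a1) (Seq (expr_code S (d + 1) a2)
      (Seq (While (busy S (slot d 1))
              (Seq (Act S (GoLeft (slot d 1))) (Act S (GoLeft i))))
      (If (AtMark S i) (Act S (GoRight i)) (clear S i))))
  | FScan P a =>
      Seq (expr_code S d a)
          (visit 0 i (If (Scan P) (Act S (GoRight i)) (Act S Nop)))
  | FBit a =>
      Seq (expr_code S d a)
          (visit 1 i (If (BitSet S) (Act S (GoRight i)) (Act S Nop)))
  | FAnd f1 f2 =>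
      Seq (form_code d f1)
          (If (AtMark S i) (Act S Nop)
              (Seq (Act S (GoLeft i)) (form_code d f2)))
  | FOr f1 f2 =>
      Seq (form_code d f1) (If (AtMark S i) (form_code d f2) (Act S Nop))
  | FEx a f1 =>
      Seq (expr_code S d a)
      (Seq (While (TAnd (busy S i) (AtMark S (slot d 1)))
              (Seq (Act S (GoLeft i)) (form_code (d + 1) f1)))
      (Seq (clear S i) (pour S (slot d 1) i)))
  end.

Definition form_spec (f : form S) (k : nat) : Prop :=
  forall (w : seq S) r e M X, 1 < X -> size w <= X -> all (leq^~ X) e ->
    scoped (size e) f ->
    exec_within w (form_code (size e) f) (stack r e, M) (X ^ k)
      (stack r (e ++ [:: nat_of_bool (satb w M e f)]), M).

Lemma slotS d k : (slot d k).+1 = slot d k.+1.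
Proof. by rewrite /slot addnS. Qed.

Lemma within_probe w r e v M i b (x : bool) : i < 2 ->
  (forall q, q i = v.+1 -> run_test w b (q, M) = x) ->
  exec_within w
    (visit i (slot (size e) 0)
       (If b (Act S (GoRight (slot (size e) 0))) (Act S Nop)))
    (stack r (e ++ [:: v]), M) (v * 7 + 2 + 4)
    (stack r (e ++ [:: nat_of_bool x]), M).
Proof.
move=> lti bx; set j := slot (size e) 0.
have := @within_visit S w i j (If b (Act S (GoRight j)) (Act S Nop))
  (stack r (e ++ [:: v])) M x M 2.
rewrite upd_slot /j slotS !stack_slot /=; apply=> //.
- by rewrite /slot; lia.
- by case: i lti {bx} => [|[|i]].
move=> q qi qj; apply: within_if; rewrite (bx _ qi).
case: x {bx}; last first.
  have -> : upd q (slot (size e) 0) false = q by funeq.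
  exact: within_act.
have -> : (upd q (slot (size e) 0) true, M) =
    run_instr (GoRight (slot (size e) 0)) (q, M) by rewrite /= qj.
exact: within_act.
Qed.

(** The loop of a quantifier: [c] evaluates the predicate [P] at the top of the
    stack. *)
Lemma within_search w r e v M (c : com S) (P : pred nat) T :
  (forall x, x < v -> exec_within w c (stack r (e ++ [:: x]), M) T
     (stack r (e ++ [:: x; nat_of_bool (P x)]), M)) ->
  exists2 m, m <= v &
  exec_within w
    (While (TAnd (busy S (slot (size e) 0)) (AtMark S (slot (size e) 1)))
              (Seq (Act S (GoLeft (slot (size e) 0))) c))
    (stack r (e ++ [:: v]), M) (v * T.+2).+1
    (stack r (e ++ [:: m; nat_of_bool (has P (iota 0 v))]), M).
Proof.
elim: v => [|v IH] cP.
  exists 0 => //; rewrite stack_cat10; exists 1 => //.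
  by apply: exec_while_stop; rewrite /= stack_slot.
have [|m lem [t2 le2 ex2]] := IH; first by move=> x ltx; apply: cP; lia.
have [t1 le1 ex1] := cP v (ltnSn v).
have ex01 : exec w (Seq (Act S (GoLeft (slot (size e) 0))) c)
    (stack r (e ++ [:: v.+1]), M) (1 + t1)
    (stack r (e ++ [:: v; nat_of_bool (P v)]), M).
  apply: exec_seq ex1; have := exec_act w (GoLeft (slot (size e) 0))
    (stack r (e ++ [:: v.+1]), M).
  by rewrite /= stack_slot upd_slot.
have guard : run_test w (TAnd (busy S (slot (size e) 0)) (AtMark S (slot (size e) 1)))
    (stack r (e ++ [:: v.+1]), M) by rewrite /= !stack_slot.
rewrite -addn1 iotaD has_cat /= orbF add0n.
case Pv: (P v) ex01 => ex01.
  rewrite orbT; exists v; first exact: leq_addr.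
  rewrite addn1; exists (1 + t1 + 1).+1; first by rewrite mulSn; lia.
  apply: exec_while_loop guard ex01 _.
  by apply: exec_while_stop; rewrite /= !stack_slot /= andbF.
rewrite orbF; exists m; first by lia.
rewrite addn1; exists (1 + t1 + t2).+1; first by rewrite mulSn; lia.
by apply: exec_while_loop guard ex01 _; rewrite stack_cat10.
Qed.

Lemma form_code_ok f : exists k, form_spec f k.
Proof.
elim: f => [a1 a2|P a|a|f1 [k1 IH1] f2 [k2 IH2]|f1 [k1 IH1] f2 [k2 IH2]
  |a f1 [k1 IH1]].
- have [kv1 [kt1 IH1]] := expr_code_ok S a1.
  have [kv2 [kt2 IH2]] := expr_code_ok S a2.
  eexists => w r e M X X2 wX eX /= /andP[s1 s2].
  have [v1X t1X] := IH1 w r e M X X2 wX eX s1.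
  set v1 := eval (size w) e a1 in v1X t1X *.
  have := IH2 w r (e ++ [:: v1]) M _ (pow_gt1 _ X2) (le_pow _ X2 wX) (all_pow X2 eX v1X).
  rewrite size_cat /= (scoped_expr_le _ s2) ?leq_addr // => /(_ isT).
  rewrite -!expnM (eval_cat _ _ s2) => -[v2X t2X].
  set v2 := eval (size w) e a2 in v2X t2X *.
  eapply within_le; first last.
    apply: within_seq t1X (within_seq t2X _); rewrite -catA /=.
    (* As counters do not fall below 0, decreasing [v1] by [v2] gives 0 exactly
       if [v1 <= v2]. *)
    pose f l : store := (stack r (e ++ [:: v1 - (v2 - l); l]), M).
    have -> : (stack r (e ++ [:: v1; v2]), M) = f v2.
      by rewrite /f subnn subn0.
    apply: within_seq (within_count (f := f) (T := 2) _ _) _.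
    + move=> l lel.
      apply: (@within_seq _ _ _ _ _ 1
        (stack r (e ++ [:: v1 - (v2 - l.+1); l]), M) 1).
        have := within_act w (GoLeft (slot (size e) 1)) (f l.+1).
        by rewrite /f /= stack_slot upd_slot.
      have := within_act w (GoLeft (slot (size e) 0))
        (stack r (e ++ [:: v1 - (v2 - l.+1); l]), M).
      by rewrite /f /= stack_slot upd_slot /= -subnS subnSK.
    + by move=> l lel; rewrite /busy /= stack_slot lt0n.
    rewrite /f subn0 stack_cat10; apply: within_if; rewrite /= stack_slot /=.
    apply: (@within_le _ _ _ _ (v1 * 2).+1); first exact: leqnn.
    rewrite -/(v1 <= v2); case: (leqP v1 v2) => le12.
      apply: (@within_le _ _ _ _ 1) => //.
      have := within_act w (GoRight (slot (size e) 0))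
        (stack r (e ++ [:: v1 - v2]), M).
      rewrite /= stack_slot upd_slot /=; move: le12; rewrite -subn_eq0 => /eqP ->.
      exact.
    have := within_clear w (slot (size e) 0) (stack r (e ++ [:: v1 - v2])) M.
    by rewrite stack_slot upd_slot /=; apply: within_le; lia.
  by pow_bound.
- have [kv [kt IH]] := expr_code_ok S a.
  eexists => w r e M X X2 wX eX /= s1.
  have [vX tX] := IH w r e M X X2 wX eX s1.
  eapply within_le; first last.
    apply: within_seq tX (@within_probe w r e _ M 0 _
      (P (onth w (eval (size w) e a))) _ _) => //=.
    by move=> q ->.
  by pow_bound.
- have [kv [kt IH]] := expr_code_ok S a.
  eexists => w r e M X X2 wX eX /= s1.
  have [vX tX] := IH w r e M X X2 wX eX s1.
  eapply within_le; first last.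
    apply: within_seq tX (@within_probe w r e _ M 1 _
      (M (eval (size w) e a)) _ _) => //=.
    by move=> q ->.
  by pow_bound.
- eexists => w r e M X X2 wX eX /= /andP[s1 s2].
  have t1X := IH1 w r e M X X2 wX eX s1.
  have t2X := IH2 w r e M X X2 wX eX s2.
  eapply within_le; first last.
    apply: within_seq t1X (within_if _); rewrite /= stack_slot /=.
    apply: (@within_le _ _ _ _ (1 + X ^ k2)); first exact: leqnn.
    case: (satb w M e f1) => /=.
      apply: within_seq _ t2X.
      have := within_act w (GoLeft (slot (size e) 0)) (stack r (e ++ [:: 1]), M).
      by rewrite /= stack_slot upd_slot /= stack_cat0.
    apply: (@within_le _ _ _ _ 1) => //; exact: within_act.
  by pow_bound.
- eexists => w r e M X X2 wX eX /= /andP[s1 s2].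
  have t1X := IH1 w r e M X X2 wX eX s1.
  have t2X := IH2 w r e M X X2 wX eX s2.
  eapply within_le; first last.
    apply: within_seq t1X (within_if _); rewrite /= stack_slot /=.
    apply: (@within_le _ _ _ _ (1 + X ^ k2)); first exact: leqnn.
    case: (satb w M e f1) => /=.
      apply: (@within_le _ _ _ _ 1) => //; exact: within_act.
    by rewrite stack_cat0; apply: within_le t2X; rewrite leq_addl.
  by pow_bound.
- have [kv [kt IH]] := expr_code_ok S a.
  eexists => w r e M X X2 wX eX /= /andP[s1 s2].
  have [vX tX] := IH w r e M X X2 wX eX s1.
  set v := eval (size w) e a in vX tX *.
  set P := (X in has X).
  have [|m lem t1X] := @within_search w r e v M (form_code (size e + 1) f1) P
    (X ^ (kv.+1 * k1)).
    move=> x ltx; have xX : x <= X ^ kv by apply: leq_trans (ltnW ltx) vX.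
    have := IH1 w r (e ++ [:: x]) M _ (pow_gt1 _ X2) (le_pow _ X2 wX) (all_pow X2 eX xX).
    by rewrite size_cat addn1 => /(_ s2); rewrite -expnM -catA /P cats1.
  have mX : m <= X ^ kv by apply: leq_trans lem vX.
  eapply within_le; first last.
    apply: within_seq tX (within_seq t1X (within_seq (within_clear _ _ _ _) _)).
    rewrite upd_slot /=.
    have := @within_pour S w (slot (size e) 1) (slot (size e) 0)
      (stack r (e ++ [:: 0; nat_of_bool (has P (iota 0 v))])) M.
    rewrite !stack_slot !upd_slot /= stack_cat10 add0n.
    move=> /(_ _)/wrap[]; first by rewrite /slot; lia.
    by move=> h; apply: (@within_le _ _ _ _ _ 4) h; case: has.
  by rewrite stack_slot /=; pow_bound.
Qed.

End FormCode.

(** * Least fixed points *)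

Section FixedPoint.
Variables (S : finType) (sz : expr) (f : form S).

(** Closure of [X] under the formula [f], in which an address below the value of
    [sz] is the only free variable. *)
Definition form_closed (w : seq S) (X : nat -> Prop) : Prop :=
  forall a, a < eval (size w) [::] sz -> sat w X [:: a] f -> X a.

(** Add the address [a] to the set if [f] holds for it. *)
Definition update (w : seq S) (a : nat) (M : nat -> bool) : nat -> bool :=
  if satb w M [:: a] f then upd M a true else M.

(** The addresses below [v] are updated in decreasing order; these are the first
    [n] of them. *)
Fixpoint sweep (w : seq S) (v n : nat) (M : nat -> bool) : nat -> bool :=
  if n is n'.+1 then update w (v - n) (sweep w v n' M) else M.

Section Semantics.
Variable w : seq S.

Let v := eval (size w) [::] sz.

(** One round of updates, of all addresses below [v]. *)
Definition round (M : nat -> bool) : nat -> bool := sweep w v v M.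

Lemma update_sub a (M : nat -> bool) b : M b -> update w a M b.
Proof. by rewrite /update /upd => Mb; case: ifP => // _; case: eqP. Qed.

Lemma sweep_sub n m (M : nat -> bool) b : n <= m -> sweep w v n M b -> sweep w v m M b.
Proof.
elim: m => [|m IH]; first by rewrite leqn0 => /eqP ->.
by rewrite leq_eqVlt => /predU1P[->//|le /IH] Mb; apply: update_sub; apply: Mb.
Qed.

Lemma sweep_out n (M : nat -> bool) b : n <= v -> v <= b -> sweep w v n M b = M b.
Proof.
move=> len leb; elim: n len => //= n IH len; rewrite /update /upd.
by case: ifP => _; rewrite ?IH ?(ltnW len) //; case: eqP => //; lia.
Qed.

(** A round that changes nothing has tested the formula for each address on the
    same set [M]. *)
Lemma round_fixed M : round M = M -> form_closed w M.
Proof.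
move=> fixM a lt_a /satP sa; rewrite -/v in lt_a.
have fixn n : n <= v -> sweep w v n M = M.
  move=> len; apply: functional_extensionality => b.
  apply/idP/idP => [sb|]; last exact: (sweep_sub (leq0n n)).
  by rewrite -fixM; apply: sweep_sub sb.
have := fixn (v - a.+1).+1; rewrite /= fixn ?leq_subr //.
rewrite subnSK // subKn ?(ltnW lt_a) // /update sa => <- //; last exact: leq_subr.
by rewrite /upd eqxx.
Qed.

(** The number of addresses in the set. *)
Let size_of (M : nat -> bool) := count M (iota 0 v).

Lemma round_grows M : size_of (round M) <= size_of M -> round M = M.
Proof.
move=> le_size; apply: functional_extensionality => b.
have sub c : M c -> round M c by apply: (@sweep_sub 0).
case: (ltnP b v) => [ltb|]; last exact: sweep_out.
apply/idP/idP; last exact: sub.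
move=> Rb; apply: contraLR le_size => nMb; rewrite -ltnNge.
rewrite /size_of.
have -> : iota 0 v = iota 0 b ++ b :: iota b.+1 (v - b.+1).
  by rewrite -[b :: _]/(iota b (v - b.+1).+1) subnSK // -iotaD subnKC // ltnW.
rewrite !count_cat /= Rb (negbTE nMb) add0n add1n addnS ltnS.
by apply: leq_add; apply: sub_count.
Qed.

Lemma rounds_fixed n M : round (iter n round M) = iter n round M \/
  n <= size_of (iter n round M).
Proof.
elim: n => [|n IH]; first by right.
case: (leqP (size_of (iter n.+1 round M)) (size_of (iter n round M))).
  by move/round_grows => /= e; left; rewrite e.
case: IH => [e _|le lt]; first by left; rewrite /= !e.
by right; apply: leq_ltn_trans lt.
Qed.

Lemma rounds_closed M : form_closed w (iter v round M).
Proof.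
case: (rounds_fixed v M) => [/round_fixed // | le a lt_a _].
have : all (iter v round M) (iota 0 v).
  by rewrite all_count eqn_leq count_size size_iota.
by move/allP; apply; rewrite mem_iota.
Qed.

(** As the formula is positive, only members of all closed sets are added. *)
Lemma rounds_least (X : nat -> Prop) (n : nat) : form_closed w X ->
  forall b, iter n round (fun=> false) b -> X b.
Proof.
move=> clX; elim: n => [|n IH] b //=; set M := iter n round _ in IH *.
suff sweepX m : m <= v -> forall c, sweep w v m M c -> X c by exact: (sweepX v).
elim: m => [|m IHm] lem c /=; first exact: IH.
rewrite /update; case: ifP => [/satP sa|_]; last exact: IHm (ltnW lem) c.
rewrite /upd; case: eqP => [-> _|_]; last exact: IHm (ltnW lem) c.
apply: clX; first by rewrite -/v; lia.
by apply: sat_mono sa => a; apply: IHm (ltnW lem) a.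
Qed.

End Semantics.

(** The truth value of [f] is above the address [a], which is entry 0; if it is
    1, a copy of [a] is used up in order to visit bit [a] of the memory. *)
Definition update_code : com S :=
  let i := slot 1 0 in
  If (AtMark S i) (Act S Nop)
    (Seq (Act S (GoLeft i))
    (Seq (expr_code S 1 (EVar 0)) (visit 1 i (Act S SetBit)))).

Definition round_code : com S :=
  let i := slot 0 0 in
  Seq (expr_code S 0 sz)
    (While (busy S i) (Seq (Act S (GoLeft i)) (Seq (form_code 1 f) update_code))).

(** Counter 2 holds the number of rounds that are still to be made.  The last
    instruction moves to the bit of address 0. *)
Definition fixpoint_code : com S :=
  Seq (expr_code S 0 sz)
  (Seq (pour S (slot 0 0) 2)
  (Seq (While (busy S 2) (Seq (Act S (GoLeft 2)) round_code))
       (Act S (GoRight 1)))).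

Hypothesis sz_closed : scoped_expr 0 sz.
Hypothesis f_scoped : scoped 1 f.

Let slot1 r a l k : stack r (a :: l) (slot 1 k) = nth 0 l k.
Proof. exact: (@stack_slot r [:: a]). Qed.

Let upd1 r a l k v :
  upd (stack r (a :: l)) (slot 1 k) v = stack r (a :: set_nth 0 l k v).
Proof. exact: (@upd_slot r [:: a]). Qed.

Let pop1 r a : stack r [:: a; 0] = stack r [:: a].
Proof. exact: (@stack_cat0 r [:: a]). Qed.

Let slot0 r l k : stack r l (slot 0 k) = nth 0 l k.
Proof. exact: (@stack_slot r [::]). Qed.

Let upd0 r l k v : upd (stack r l) (slot 0 k) v = stack r (set_nth 0 l k v).
Proof. exact: (@upd_slot r [::]). Qed.

Let pop0 r : stack r [:: 0] = stack r [::].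
Proof. exact: (@stack_cat0 r [::]). Qed.

Lemma update_code_ok : exists k, forall w r a M X,
  1 < X -> size w <= X -> a <= X ->
  exec_within w update_code
    (stack r ([:: a] ++ [:: nat_of_bool (satb w M [:: a] f)]), M) (X ^ k)
    (stack r [:: a], update w a M).
Proof.
have [kv [kt IH]] := expr_code_ok S (EVar 0).
eexists => w r a M X X2 wX aX; have aX1 : a <= X ^ 1 by rewrite expn1.
eapply within_le; first last.
  apply: within_if; rewrite /= slot1 /update.
  have leX : all (leq^~ X) [:: a] by rewrite /= aX.
  have [//|/= _ tX] := IH w r [:: a] M X X2 wX leX.
  apply: (@within_le _ _ _ _ (1 + (X ^ kt + (a * 7 + 1 + 4)))); first exact: leqnn.
  case: (satb w M [:: a] f) => /=; last first.
    rewrite pop1; apply: (@within_le _ _ _ _ 1) => //.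
    exact: within_act.
  apply: within_seq (within_seq tX _).
    have := within_act w (GoLeft (slot 1 0)) (stack r ([:: a] ++ [:: 1]), M).
    by rewrite /= upd1 /= pop1.
  have := @within_visit S w 1 (slot 1 0) (Act S SetBit)
    (stack r ([:: a] ++ [:: a])) M 0 (upd M a true) 1.
  rewrite upd1 slotS !slot1 /= pop1.
  apply=> // q q1 qj.
  have -> : (upd q (slot 1 0) 0, upd M a true) = run_instr SetBit (q, M).
    by rewrite /= q1; congr pair; funeq.
  exact: within_act.
by pow_bound.
Qed.

Lemma round_code_ok : exists k, forall w r M X, 1 < X -> size w <= X ->
  exec_within w round_code (stack r [::], M) (X ^ k)
    (stack r [::], round w M).
Proof.
have [kv [kt IHv]] := expr_code_ok S sz.
have [kf IHf] := form_code_ok f.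
have [ku IHu] := update_code_ok.
eexists => w r M X X2 wX.
have [//|//|vX tX] := IHv w r [::] M X X2 wX.
eapply within_le; first last.
  rewrite /round; set v := eval _ _ _ in vX tX *.
  apply: within_seq tX _ => /=.
  pose g l : store := (stack r [:: l], sweep w v (v - l) M).
  have -> : (stack r [:: v], M) = g v by rewrite /g subnn.
  have -> : (stack r [::], sweep w v v M) = g 0.
    by rewrite /g subn0 pop0.
  apply: (within_count (f := g) (T := 1 + (X ^ (kv.+1 * kf) + X ^ (kv.+1 * ku)))).
    move=> l lel; have lX : l <= X ^ kv by apply: leq_trans (ltnW lel) vX.
    have Y2 := pow_gt1 kv X2; have wY := le_pow kv X2 wX.
    have lY := @all_pow X kv l [::] X2 isT lX.
    have lY1 : l <= X ^ kv.+1 by case/andP: lY.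
    have eg : (stack r [:: l], sweep w v (v - l.+1) M) =
        run_instr (GoLeft (slot 0 0)) (g l.+1).
      by rewrite /g /= upd0.
    apply: within_seq (within_act _ _ _) _; rewrite -eg.
    have tf := IHf w r [:: l] (sweep w v (v - l.+1) M) _ Y2 wY lY f_scoped.
    have tu := IHu w r l (sweep w v (v - l.+1) M) _ Y2 wY lY1.
    rewrite -!expnM in tf tu; apply: within_seq tf _.
    move: tu; congr (exec_within _ _ _ _ (_, _)).
    by rewrite -(subnSK lel) /= subnSK // subKn // ltnW.
  by move=> l lel; rewrite /busy /= slot0 lt0n.
by pow_bound.
Qed.

Lemma fixpoint_code_ok : exists k, forall w,
  exists t s, [/\ exec w fixpoint_code blank_store t s,
    t <= (size w).+2 ^ k
  & run_test w (BitSet S) s =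
    iter (eval (size w) [::] sz) (round w) (fun=> false) 0].
Proof.
have [kv [kt IHv]] := expr_code_ok S sz.
have [kr IHr] := round_code_ok.
pose final w : store := (upd (stack 0 [::]) 1 1,
  iter (eval (size w) [::] sz) (round w) (fun=> false)).
suff [k kP] : exists k, forall w X, 1 < X -> size w <= X ->
    exec_within w fixpoint_code blank_store (X ^ k) (final w).
  exists k => w; have [//||t le_t ex] := kP w (size w).+2.
    by rewrite leqW.
  by exists t, (final w); split.
eexists => w X X2 wX.
have [//|//|vX tX] := IHv w 0 [::] (fun=> false) X X2 wX.
eapply within_le; first last.
  have -> : blank_store = (stack 0 [::], fun=> false).
    congr pair; apply: functional_extensionality => -[|[|[|i]]];
      by rewrite /stack ?nth_nil.
  rewrite /final; set v := eval _ _ _ in vX tX *.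
  apply: within_seq tX (within_seq (@within_pour S w _ _ _ _ _) _) => //=.
  pose g l : store := (stack l [::], iter (v - l) (round w) (fun=> false)).
  rewrite slot0 /=.
  have -> : (upd (upd (stack 0 [:: v]) 2 (stack 0 [:: v] 2 + v)) (slot 0 0) 0,
      fun=> false) = g v.
    rewrite /g subnn; congr pair.
    apply: functional_extensionality => -[|[|[|[|i]]]];
      by rewrite /upd /stack /slot /= ?nth_nil.
  apply: within_seq (within_count (f := g) (T := 1 + X ^ kr) _ _) _.
  - move=> l lel; apply: within_seq (within_act _ _ _) _.
    have := IHr w l (iter (v - l.+1) (round w) (fun=> false)) X X2 wX.
    congr (exec_within _ _ (_, _) _ (_, _)).
      by apply: functional_extensionality => -[|[|[|i]]]; rewrite /upd /stack /=.
    by rewrite -(subnSK lel).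
  - by move=> l lel; rewrite /busy /= lt0n.
  rewrite /g subn0; exact: within_act.
by rewrite slot0 /=; pow_bound.
Qed.

(** The least fixed point is described as the intersection of all closed
    sets. *)
Theorem PTIME_least_fixpoint (L : seq S -> Prop) :
  (forall w, L w <-> forall X : nat -> Prop, form_closed w X -> X 0) -> PTIME L.
Proof.
move=> LP; have [k kP] := fixpoint_code_ok.
apply: (@PTIME_program S fixpoint_code (BitSet S) L k) => w.
have [t [s [ex le_t res]]] := kP w; exists t, s; split=> //.
rewrite LP res; split=> [M0 X clX|].
  exact: rounds_least clX _ M0.
move=> /(_ _ (@rounds_closed w _)); exact.
Qed.

End FixedPoint.

(** * Rules *)

Section Rules.
Variables (S : finType) (tag : Type) (code : tag -> nat) (ntags : nat).
Hypothesis code_inj : injective code.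
Hypothesis code_lt : forall t, code t < ntags.

(** Arguments of facts range over the numbers from 0 to the length [n] of the
    word, so that [n + 1] is their number. *)
Definition ESize : expr := EAdd ELen (ECst 1).

(** The address of a fact: its tag and its four arguments are read as digits in
    base [n + 1], with the code of the tag as the leading one. *)
Definition EAddr (t : tag) (b c d e : expr) : expr :=
  EAdd (EMul (EAdd (EMul (EAdd (EMul (EAdd (EMul (ECst (code t)) ESize) b)
    ESize) c) ESize) d) ESize) e.

Definition addr (n : nat) (t : tag) (b c d e : nat) : nat :=
  (((code t * (n + 1) + b) * (n + 1) + c) * (n + 1) + d) * (n + 1) + e.

(** All addresses of facts are less than this number. *)
Definition EBound : expr :=
  EMul (EMul (EMul (EMul (ECst ntags) ESize) ESize) ESize) ESize.

Lemma addr_inj n t b c d e t' b' c' d' e' :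
  b <= n -> c <= n -> d <= n -> e <= n ->
  b' <= n -> c' <= n -> d' <= n -> e' <= n ->
  addr n t b c d e = addr n t' b' c' d' e' ->
  [/\ t = t', b = b', c = c', d = d' & e = e'].
Proof.
have pairI x y x' y' : y <= n -> y' <= n ->
    x * (n + 1) + y = x' * (n + 1) + y' -> x = x' /\ y = y'.
  rewrite addn1 -[y <= n]ltnS -[y' <= n]ltnS => lty lty' exy.
  have := congr1 (fun z => z %/ n.+1) exy.
  rewrite !divnMDl // !divn_small // !addn0 => ex; split=> //.
  by move: exy; rewrite ex => /addnI.
move=> lb lc ld le lb' lc' ld' le'.
case/(pairI _ _ _ _ le le') => /(pairI _ _ _ _ ld ld')[].
by case/(pairI _ _ _ _ lc lc') => /(pairI _ _ _ _ lb lb')[/code_inj -> -> -> -> ->].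
Qed.

Lemma addr_lt n t b c d e : b <= n -> c <= n -> d <= n -> e <= n ->
  addr n t b c d e < eval n [::] EBound.
Proof.
have pair_lt x y m : x < m -> y <= n -> x * (n + 1) + y < m * (n + 1).
  move=> ltx ley; apply: (@leq_trans (x.+1 * (n + 1))); last first.
    by rewrite leq_mul2r ltx orbT.
  by rewrite mulSn [X in _ < X]addnC ltn_add2l addn1 ltnS.
move=> lb lc ld le; rewrite /addr /=.
by do 4![apply: (pair_lt) => //]; apply: code_lt.
Qed.

(** The fact with tag [t] and arguments [b], [c], [d] and [e] holds. *)
Definition Fact (t : tag) (b c d e : expr) : form S := FBit S (EAddr t b c d e).
Definition FLt (a b : expr) : form S := FLe S (EAdd a (ECst 1)) b.
Definition FEq (a b : expr) : form S := FAnd (FLe S a b) (FLe S b a).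
Definition FTrue : form S := FLe S (ECst 0) (ECst 0).

(** From [rule_body], conclude the fact with tag [rule_tag] and arguments
    [rule_1] to [rule_4].  The variables of a rule are [EVar 1], ...,
    [EVar rule_vars] and range over the numbers up to the length of the word;
    [EVar 0] stands for the address of the conclusion. *)
Record rule : Type := Rule {
  rule_vars : nat;
  rule_tag : tag;
  rule_1 : expr; rule_2 : expr; rule_3 : expr; rule_4 : expr;
  rule_body : form S
}.

(** [k] quantifiers over the numbers up to the length of the word. *)
Fixpoint exs (k : nat) (f : form S) : form S :=
  if k is k'.+1 then FEx ESize (exs k' f) else f.

(** The address given by variable 0 is that of a conclusion of the rule [r], all
    whose arguments are in range. *)
Definition rule_form (r : rule) : form S :=
  exs (rule_vars r)
    (FAnd (FEq (EVar 0)
             (EAddr (rule_tag r) (rule_1 r) (rule_2 r) (rule_3 r) (rule_4 r)))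
    (FAnd (FAnd (FAnd (FLe S (rule_1 r) ELen) (FLe S (rule_2 r) ELen))
                (FAnd (FLe S (rule_3 r) ELen) (FLe S (rule_4 r) ELen)))
          (rule_body r))).

Definition rules_form (rs : seq rule) : form S :=
  foldr (fun r f => FOr (rule_form r) f) (FLt (ECst 0) (ECst 0)) rs.

(** [P] holds for all lists of [k] numbers up to [n]; the quantifiers are
    explicit when [k] is. *)
Fixpoint all_vars (n k : nat) (P : seq nat -> Prop) : Prop :=
  if k is k'.+1 then
    forall x, x <= n -> all_vars n k' (fun xs => P (x :: xs))
  else P [::].

Lemma all_varsP n k (P : seq nat -> Prop) : all_vars n k P <->
  forall xs, size xs = k -> all (leq^~ n) xs -> P xs.
Proof.
elim: k P => [|k IH] P /=.
  by split=> [P0 xs /size0nil -> //|]; apply.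
split=> [Px [|x xs] //= [sz] /andP[lex le_xs]|Px x lex].
  by have /IH := Px x lex; apply.
by apply/IH => xs sz le_xs; apply: Px; rewrite /= ?sz ?lex.
Qed.

Lemma sat_exs w X k f e : sat w X e (exs k f) <->
  exists xs, [/\ size xs = k, all (leq^~ (size w)) xs & sat w X (e ++ xs) f].
Proof.
elim: k e => [|k IH] e /=.
  split=> [sf|[xs [/size0nil -> _]]]; last by rewrite cats0.
  by exists [::]; rewrite cats0.
split=> [[x ltx /IH[xs [sz le_xs sf]]]|[[|x xs] [//= [sz] /andP[lex le_xs] sf]]].
  exists (x :: xs); rewrite -cat_rcons /= sz le_xs andbT; split=> //.
  by rewrite addn1 in ltx.
exists x; first by rewrite addn1 ltnS.
by apply/IH; exists xs; rewrite cat_rcons.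
Qed.

Lemma sat_rules w X e rs : sat w X e (rules_form rs) <->
  exists2 r, List.In r rs & sat w X e (rule_form r).
Proof.
elim: rs => [|r rs IH] /=; first by split=> // -[].
rewrite IH; split=> [[sr|[r' inr' sr']]|[r' [->|inr'] sr']].
- by exists r => //; left.
- by exists r' => //; right.
- by left.
- by right; exists r'.
Qed.

(** The set of addresses that is given by an interpretation of the tags.  An
    address that is not the address of a fact is in it by default. *)
Definition addressed (n : nat) (mean : tag -> nat -> nat -> nat -> nat -> Prop)
    (a : nat) : Prop :=
  forall t b c d e, b <= n -> c <= n -> d <= n -> e <= n ->
    a = addr n t b c d e -> mean t b c d e.

(** The rule [r] is sound for the interpretation [mean] of the tags. *)
Definition respects (w : seq S)
    (mean : tag -> nat -> nat -> nat -> nat -> Prop) (r : rule) : Prop :=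
  forall a, all_vars (size w) (rule_vars r) (fun xs =>
    let v := eval (size w) (a :: xs) in
    sat w (addressed (size w) mean) (a :: xs) (rule_body r) ->
    v (rule_1 r) <= size w -> v (rule_2 r) <= size w ->
    v (rule_3 r) <= size w -> v (rule_4 r) <= size w ->
    mean (rule_tag r) (v (rule_1 r)) (v (rule_2 r)) (v (rule_3 r)) (v (rule_4 r))).

Lemma sat_fact w X e t b1 b2 b3 b4 : sat w X e (Fact t b1 b2 b3 b4) =
  X (addr (size w) t (eval (size w) e b1) (eval (size w) e b2)
       (eval (size w) e b3) (eval (size w) e b4)).
Proof. by []. Qed.

Lemma sat_addressed w mean e t b1 b2 b3 b4 : let v := eval (size w) e in
  v b1 <= size w -> v b2 <= size w -> v b3 <= size w -> v b4 <= size w ->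
  sat w (addressed (size w) mean) e (Fact t b1 b2 b3 b4) ->
  mean t (v b1) (v b2) (v b3) (v b4).
Proof. by move=> v l1 l2 l3 l4; apply. Qed.

(** Sound rules make the intended interpretation a closed set. *)
Lemma closed_addressed w mean rs : (forall r, List.In r rs -> respects w mean r) ->
  form_closed EBound (rules_form rs) w (addressed (size w) mean).
Proof.
move=> rsP a _ /sat_rules[r inr /sat_exs[xs [sz le_xs /=]]].
case=> -[le1 le2] [[[l1 l2] [l3 l4]] sb].
have /all_varsP/(_ xs sz le_xs sb l1 l2 l3 l4) mr := rsP r inr a.
move=> t b c d e lb lc ld le ea.
have /(addr_inj lb lc ld le l1 l2 l3 l4)[-> -> -> -> -> //] :
  addr (size w) t b c d e = addr (size w) (rule_tag r)
    (eval (size w) (a :: xs) (rule_1 r)) (eval (size w) (a :: xs) (rule_2 r))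
    (eval (size w) (a :: xs) (rule_3 r)) (eval (size w) (a :: xs) (rule_4 r)).
by rewrite -ea; apply/eqP; rewrite eqn_leq le1 le2.
Qed.

(** An instance of a rule, in which [xs] are the values of the variables, can be
    applied in a closed set. *)
Lemma closed_derive w X rs (r : rule) (xs : seq nat) (b c d e : nat) :
  form_closed EBound (rules_form rs) w X -> List.In r rs ->
  let a := addr (size w) (rule_tag r) b c d e in
  let v := eval (size w) (a :: xs) in
  size xs = rule_vars r -> all (leq^~ (size w)) xs ->
  [/\ v (rule_1 r) = b, v (rule_2 r) = c, v (rule_3 r) = d & v (rule_4 r) = e] ->
  [/\ b <= size w, c <= size w, d <= size w & e <= size w] ->
  sat w X (a :: xs) (rule_body r) -> X (addr (size w) (rule_tag r) b c d e).
Proof.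
move=> clX inr a v sz le_xs [eb ec ed ee] [lb lc ld le] sb.
apply: clX; first exact: addr_lt.
apply/sat_rules; exists r => //.
apply/sat_exs; exists xs; split=> //=.
rewrite -/(v (rule_1 r)) -/(v (rule_2 r)) -/(v (rule_3 r)) -/(v (rule_4 r)).
by rewrite eb ec ed ee lb lc ld le; do !split.
Qed.

End Rules.
Arguments Fact : simpl never.

(** * Instances of the axioms in context *)

(** Disjunction ([o = true]) and conjunction ([o = false]).  The axioms are
    symmetric under their exchange together with that of the constants. *)
Definition Op (o : bool) (f g : term) : term := if o then Or f g else And f g.

(** Substitution instances of the axioms, without the context. *)
Inductive BA_instance : term -> term -> Prop :=
| BAi_neg b : BA_instance (Neg (Cst b)) (Cst (~~ b))
| BAi_unit o f : BA_instance (Op o (Cst (~~ o)) f) f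
| BAi_compl o f : BA_instance (Op o f (Neg f)) (Cst o)
| BAi_comm o f g : BA_instance (Op o f g) (Op o g f)
| BAi_assoc o f g h :
    BA_instance (Op o f (Op o g h)) (Op o (Op o f g) h)
| BAi_distr o f g h :
    BA_instance (Op o f (Op (~~ o) g h)) (Op (~~ o) (Op o f g) (Op o f h)).

(** [s] becomes [t] by a replacement according to one axiom, in either
    direction, at one place. *)
Inductive near : term -> term -> Prop :=
| near_BA s t : BA_instance s t -> near s t
| near_AB s t : BA_instance t s -> near s t
| near_neg s t : near s t -> near (Neg s) (Neg t)
| near_opl o s t r : near s t -> near (Op o s r) (Op o t r)
| near_opr o s t r : near s t -> near (Op o r s) (Op o r t).

Lemma BA_instanceP s t : BA_instance s t <->
  exists u v sigma, [/\ BA u v, s = subst sigma u & t = subst sigma v].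
Proof.
split; last first.
  case=> u [v [sigma [[] -> ->]]] /=.
  - exact: (BAi_neg false).
  - exact: (BAi_neg true).
  - exact: (BAi_unit true).
  - exact: (BAi_unit false).
  - exact: (BAi_compl true).
  - exact: (BAi_compl false).
  - exact: (BAi_comm true).
  - exact: (BAi_comm false).
  - exact: (BAi_assoc true).
  - exact: (BAi_assoc false).
  - exact: (BAi_distr true).
  - exact: (BAi_distr false).
have wit u v (l : seq term) : BA u v ->
    exists u' v' sigma, [/\ BA u' v',
      subst (nth (Cst false) l) u = subst sigma u' &
      subst (nth (Cst false) l) v = subst sigma v'].
  by move=> uv; exists u, v, (nth (Cst false) l).
case=> [[]|[] f|[] f|[] f g|[] f g h|[] f g h].
- exact: (wit _ _ [::] BA_neg1).
- exact: (wit _ _ [::] BA_neg0).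
- exact: (wit _ _ [:: f] BA_or0).
- exact: (wit _ _ [:: f] BA_and1).
- exact: (wit _ _ [:: f] BA_orN).
- exact: (wit _ _ [:: f] BA_andN).
- exact: (wit _ _ [:: f; g] BA_orC).
- exact: (wit _ _ [:: f; g] BA_andC).
- exact: (wit _ _ [:: f; g; h] BA_orA).
- exact: (wit _ _ [:: f; g; h] BA_andA).
- exact: (wit _ _ [:: f; g; h] BA_orD).
- exact: (wit _ _ [:: f; g; h] BA_andD).
Qed.

Lemma subst1_id w y r : occ y w = 0 -> subst1 w y r = w.
Proof.
rewrite /subst1; elim: w => //= [x|s IH|s IHs t IHt|s IHs t IHt].
- by case: eqP.
- by move/IH ->.
- by move/eqP; rewrite addn_eq0 => /andP[/eqP/IHs -> /eqP/IHt ->].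
- by move/eqP; rewrite addn_eq0 => /andP[/eqP/IHs -> /eqP/IHt ->].
Qed.

Lemma near_subst1 w y r r' : occ y w = 1 -> near r r' ->
  near (subst1 w y r) (subst1 w y r').
Proof.
move=> + rr'; elim: w => //= [x|s IH|s IHs t IHt|s IHs t IHt].
- by rewrite /subst1 /=; case: eqP.
- by move/IH; apply: near_neg.
- case os: (occ y s) => [|[|n]] //.
    move/IHt; rewrite /subst1 /= -!/(subst1 _ _ _) !(subst1_id _ os).
    exact: (near_opr true).
  case=> ot; rewrite /subst1 /= -!/(subst1 _ _ _) !(subst1_id _ ot).
  by apply: (near_opl true); apply: IHs.
- case os: (occ y s) => [|[|n]] //.
    move/IHt; rewrite /subst1 /= -!/(subst1 _ _ _) !(subst1_id _ os).
    exact: (near_opr false).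
  case=> ot; rewrite /subst1 /= -!/(subst1 _ _ _) !(subst1_id _ ot).
  by apply: (near_opl false); apply: IHs.
Qed.

(** A bound for the variables of [t]. *)
Fixpoint fresh (t : term) : nat :=
  match t with
  | Var x => x.+1
  | Cst _ => 0
  | Neg t1 => fresh t1
  | Or t1 t2 | And t1 t2 => maxn (fresh t1) (fresh t2)
  end.

Lemma occ_fresh t y : fresh t <= y -> occ y t = 0.
Proof.
elim: t => //= [x|s IHs t IHt|s IHs t IHt].
- by move=> ltxy; rewrite ltn_eqF.
- by rewrite geq_max => /andP[/IHs -> /IHt ->].
- by rewrite geq_max => /andP[/IHs -> /IHt ->].
Qed.

Lemma occ_Op y o s t : occ y (Op o s t) = occ y s + occ y t.
Proof. by case: o. Qed.

Lemma near_context s t y : near s t -> occ y s = 0 -> occ y t = 0 ->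
  exists w r r', [/\ BA_instance r r' \/ BA_instance r' r, occ y w = 1,
    s = subst1 w y r & t = subst1 w y r'].
Proof.
elim=> {s t} [s t st|s t ts|s t _ IH|o s t r _ IH|o s t r _ IH].
- exists (Var y), s, t; rewrite /subst1 /= eqxx.
  by split=> //; left.
- exists (Var y), s, t; rewrite /subst1 /= eqxx.
  by split=> //; right.
- move=> os ot; have [w [r [r' [rr' ow -> ->]]]] := IH os ot.
  by exists (Neg w), r, r'.
- rewrite !occ_Op => /eqP; rewrite addn_eq0 => /andP[/eqP os /eqP or].
  move=> /eqP; rewrite addn_eq0 => /andP[/eqP ot _].
  have [w [u [u' [uu' ow -> ->]]]] := IH os ot.
  exists (Op o w r), u, u'; rewrite occ_Op ow or; split=> //.
    by case: o; rewrite /subst1 /= -!/(subst1 _ _ _) (subst1_id _ or).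
  by case: o; rewrite /subst1 /= -!/(subst1 _ _ _) (subst1_id _ or).
- rewrite !occ_Op => /eqP; rewrite addn_eq0 => /andP[/eqP or /eqP os].
  move=> /eqP; rewrite addn_eq0 => /andP[_ /eqP ot].
  have [w [u [u' [uu' ow -> ->]]]] := IH os ot.
  exists (Op o r w), u, u'; rewrite occ_Op ow or; split=> //.
    by case: o; rewrite /subst1 /= -!/(subst1 _ _ _) (subst1_id _ or).
  by case: o; rewrite /subst1 /= -!/(subst1 _ _ _) (subst1_id _ or).
Qed.

Lemma simBA_near s t : simBA s t <-> near s t.
Proof.
split=> [[w [y [u [v [sigma [_ uv ow -> ->]]]]]]|st].
  apply: near_subst1 ow _.
  case: uv => uv; [apply: near_BA | apply: near_AB]; apply/BA_instanceP.
    by exists u, v, sigma.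
  by exists v, u, sigma.
pose y := maxn (fresh s) (fresh t).
have os : occ y s = 0 by apply/occ_fresh/leq_maxl.
have ot : occ y t = 0 by apply/occ_fresh/leq_maxr.
have [w [r [r' [rr' ow es et]]]] := near_context st os ot.
case: rr' => /BA_instanceP[u [v [sigma [uv er er']]]].
  by exists w, y, u, v, sigma; rewrite -er -er'; split=> //; left.
by exists w, y, v, u, sigma; rewrite -er -er'; split=> //; right.
Qed.

(** * Unique readability of codes *)

Lemma binary0 : binary 0 = [::].
Proof. by rewrite /binary up_log1. Qed.

Lemma binaryS x : 0 < x -> binary x = SBit (odd x) :: binary x./2.
Proof.
move=> x_gt0; rewrite /binary up_log2S //= expn0 divn1; congr (_ :: _).
rewrite -[1]addn0 iotaDl -map_comp; apply: eq_map => i /=.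
by rewrite add1n expnS divnMA divn2.
Qed.

Lemma binary_double (b : bool) x : 0 < x.*2 + b ->
  binary (x.*2 + b) = SBit b :: binary x.
Proof.
move=> gt0; rewrite binaryS // addnC oddD odd_double half_bit_double oddb addbF.
by [].
Qed.

(** The number denoted by the longest prefix of [s] that consists of bits. *)
Fixpoint bits_value (s : seq symbol) : nat :=
  if s is SBit b :: s' then b + (bits_value s').*2 else 0.

(** What may follow the code of a gate: the beginning of another gate, the
    separator or the end of the word. *)
Definition delimiter (c : option symbol) : bool :=
  match c with Some (SBit _) | Some SComma => false | _ => true end.

Definition nonbit (c : option symbol) : bool :=
  if c is Some (SBit _) then false else true.

Lemma delimiter_nonbit c : delimiter c -> nonbit c.
Proof. by case: c => [[]|]. Qed.

Lemma bits_valueK x d : nonbit (ohead d) -> bits_value (binary x ++ d) = x.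
Proof.
move=> nd; elim/ltn_ind: x => x IH; case: (posnP x) => [->|gt0].
  by rewrite binary0; case: d nd {IH} => [|[]].
rewrite binaryS //= IH ?odd_double_half //; lia.
Qed.

Lemma binary_cat_inj x x' d d' : nonbit (ohead d) -> nonbit (ohead d') ->
  binary x ++ d = binary x' ++ d' -> x = x' /\ d = d'.
Proof.
move=> nd nd' e; have ex : x = x' by rewrite -(bits_valueK x nd) e bits_valueK.
by split=> //; move: e; rewrite ex => /eqP; rewrite eqseq_cat // => /andP[_ /eqP].
Qed.

Lemma encode_gate_inj g g' d d' : delimiter (ohead d) -> delimiter (ohead d') ->
  encode_gate g ++ d = encode_gate g' ++ d' -> g = g' /\ d = d'.
Proof.
move=> dd dd'; have nd := delimiter_nonbit dd; have nd' := delimiter_nonbit dd'.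
case: g g' => [i|b|i|i j|i j] [i'|b'|i'|i' j'|i' j'] //= [].
- by move=> /(binary_cat_inj nd nd')[-> ->].
- by move=> -> ->.
- by move=> /(binary_cat_inj nd nd')[-> ->].
- rewrite -!catA /= => /binary_cat_inj[//|//|-> []].
  by move=> /(binary_cat_inj nd nd')[-> ->].
- rewrite -!catA /= => /binary_cat_inj[//|//|-> []].
  by move=> /(binary_cat_inj nd nd')[-> ->].
Qed.

Lemma unwind_rcons gs g :
  unwind (rcons gs g) = rcons (unwind gs) (gate_fla (unwind gs) g).
Proof. by rewrite /unwind -cats1 foldl_cat. Qed.

Lemma size_unwind gs : size (unwind gs) = size gs.
Proof.
by elim/last_ind: gs => // gs g IH; rewrite unwind_rcons !size_rcons IH.
Qed.

Lemma Fla_nth n (C : circuit n) :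
  Fla C = nth (Cst false) (unwind C) (size C).-1.
Proof. by rewrite /Fla -nth_last size_unwind. Qed.

(** * Reading gates from a word *)

(** Gates for [Op]. *)
Definition GOp (o : bool) (i j : nat) : gate := if o then GOr i j else GAnd i j.

Definition op_symbol (o : bool) : symbol := if o then SOr else SAnd.

(** The part of [gate_wf] that does not depend on the number of inputs. *)
Definition gate_ordered (m : nat) (g : gate) : bool :=
  match g with
  | GInput _ | GConst _ => true
  | GNot i => i < m
  | GOr i j | GAnd i j => i < j < m
  end.

Section Reading.
Variable w : seq symbol.

Local Notation n := (size w).

(** The factor of [w] from position [p] to position [q] is [x].  It is stated
    by means of suffixes, which makes segments easy to compose. *)
Definition seg (p q : nat) (x : seq symbol) : Prop :=
  [/\ p <= n, q <= n & drop p w = x ++ drop q w].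

Lemma onth_drop p c :
  onth w p = Some c <-> p < n /\ drop p w = c :: drop p.+1 w.
Proof.
elim: w p => [|d u IH] [|p] //=; try by split=> [|[]].
by rewrite drop0; split=> [[->] //|[_ [->]]].
Qed.

Lemma ohead_drop p : ohead (drop p w) = onth w p.
Proof. by elim: w p => [|d u IH] [|p] //=. Qed.

Lemma seg_nil p : p <= n -> seg p p [::].
Proof. by []. Qed.

Lemma seg_cons p q c x :
  seg p q (c :: x) <-> onth w p = Some c /\ seg p.+1 q x.
Proof.
split=> [[lep leq e]|[/onth_drop[ltp e] [_ leq e']]]; last first.
  by split; rewrite // ?(ltnW ltp) // e e'.
have ltp : p < n.
  by rewrite ltnNge; apply/negP => /drop_oversize ep; rewrite ep in e.
have ec : drop p w = c :: drop p.+1 w.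
  by rewrite e -[p.+1]add1n -drop_drop e /= drop0.
by split; [apply/onth_drop | split=> //; move: e; rewrite ec => -[]].
Qed.

Lemma seg_size p q x : seg p q x -> q = p + size x.
Proof. by case=> lep leq /(congr1 size); rewrite size_cat !size_drop; lia. Qed.

Lemma seg_le p q x : seg p q x -> p <= n /\ q <= n.
Proof. by case. Qed.

Lemma seg_cat p q x y :
  seg p q (x ++ y) <-> exists r, seg p r x /\ seg r q y.
Proof.
elim: x p => [|c x IH] p /=.
  split=> [s|[r [/[dup] /seg_size -> _]]]; last by rewrite addn0.
  by exists p; split=> //; case: (seg_le s) => /seg_nil.
rewrite seg_cons IH; split=> [[e [r [sx sy]]]|[r [/seg_cons[e sx] sy]]].
  by exists r; rewrite seg_cons.
by split=> //; exists r.
Qed.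

Lemma seg_inj p q x x' : seg p q x -> seg p q x' -> x = x'.
Proof.
move=> s s'; have es : size x = size x'.
  by apply: (@addnI p); rewrite -(seg_size s) -(seg_size s').
case: s => _ _ e; case: s' => _ _ /eqP.
by rewrite e eqseq_cat // => /andP[/eqP].
Qed.

(** The segment from [p] to [r] is the code of [g].  Requiring that a delimiter
    follows excludes proper prefixes of a binary number. *)
Definition shape (p r : nat) (g : gate) : Prop :=
  seg p r (encode_gate g) /\ delimiter (onth w r).

Lemma shape_inj p r r' g g' : shape p r g -> shape p r' g' -> g = g' /\ r = r'.
Proof.
move=> [s d] [s' d'].
have [eg _] : g = g' /\ drop r w = drop r' w.
  apply: encode_gate_inj; rewrite ?ohead_drop //.
  by case: s => _ _ <-; case: s' => _ _ <-.
by split=> //; rewrite (seg_size s) (seg_size s') eg.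
Qed.

Lemma shape_gt0 p r g : shape p r g -> p < r.
Proof.
by case=> /seg_size -> _; case: g => * /=; rewrite addnS ltnS leq_addr.
Qed.

(** The segment from [s] to the given position encodes the given gates, whose
    wires come from earlier gates as required in a circuit. *)
Inductive parse (s : nat) : nat -> seq gate -> Prop :=
| parse_nil : s <= n -> parse s s [::]
| parse_rcons p r gs g : parse s p gs -> shape p r g ->
    gate_ordered (size gs) g -> parse s r (rcons gs g).

Lemma parse_rconsE s r gs g : parse s r (rcons gs g) -> exists p,
  [/\ parse s p gs, shape p r g & gate_ordered (size gs) g].
Proof.
move e: (rcons gs g) => l h; case: h e => [_|p {}r gs' g' ps sh og].
  by case: gs.
by move=> /rcons_inj[-> ->]; exists p.
Qed.

Lemma parse_inj s p p' gs gs' : parse s p gs -> parse s p' gs' ->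
  size gs = size gs' -> gs = gs' /\ p = p'.
Proof.
move=> h; elim: h p' gs' => {p gs} [_|p r gs g _ IH sh _] p' gs'
  [_|p0 r' gs0 g' h' sh' _] //; rewrite ?size_rcons //.
case=> /(IH _ _ h')[<- ep]; rewrite -ep in sh'.
by have [-> ->] := shape_inj sh sh'.
Qed.

Lemma parse_le s p gs : parse s p gs -> s + size gs <= p /\ p <= n.
Proof.
elim=> {p gs} [le_s|p r gs g _ [le1 le2] sh _]; first by rewrite addn0.
have := shape_gt0 sh; case: sh => /seg_le[_ ler] _.
by rewrite size_rcons addnS => ltp; split=> //; apply: leq_ltn_trans ltp.
Qed.

Lemma parse_take s p gs k : parse s p gs -> k <= size gs ->
  exists p', parse s p' (take k gs).
Proof.
elim=> {p gs} [le_s _|p r gs g h IH sh og].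
  by exists s; apply: parse_nil.
rewrite size_rcons leq_eqVlt => /predU1P[->|lek].
  by exists r; rewrite -(size_rcons gs g) take_size; apply: parse_rcons h sh og.
by rewrite -cats1 takel_cat //; apply: IH.
Qed.

Lemma parse_drop s p gs : parse s p gs ->
  drop s w = encode_gates gs ++ drop p w.
Proof.
elim=> {p gs} // p r gs g _ -> [[_ _ ->] _] _.
by rewrite /encode_gates map_rcons flatten_rcons catA.
Qed.

Lemma parse_ordered s p gs : parse s p gs -> forall m, m < size gs ->
  gate_ordered m (nth (GConst false) gs m).
Proof.
elim=> {p gs} // p r gs g _ IH _ og m; rewrite size_rcons ltnS nth_rcons.
by case: ltngtP => // [/IH //|->].
Qed.

Lemma encode_gate_delim g d : delimiter (ohead (encode_gate g ++ d)).
Proof. by case: g. Qed.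

Lemma encode_gates_parse s gs d : s <= n ->
  drop s w = encode_gates gs ++ d -> delimiter (ohead d) ->
  (forall m, m < size gs -> gate_ordered m (nth (GConst false) gs m)) ->
  exists p, [/\ parse s p gs, p <= n & drop p w = d].
Proof.
move=> les; elim/last_ind: gs d => [|gs g IH] d.
  by move=> e _ _; exists s; split=> //; apply: parse_nil.
rewrite /encode_gates map_rcons flatten_rcons -/(encode_gates gs) -catA.
move=> e dd og; have [||p [h lep ep]] := IH _ e; first exact: encode_gate_delim.
  move=> m ltm; have := og m; rewrite size_rcons nth_rcons ltm.
  by apply; apply: ltnW.
pose r := p + size (encode_gate g).
have er : drop r w = d by rewrite /r addnC -drop_drop ep drop_size_cat.
have ler : r <= n.
  by move: (congr1 size ep); rewrite size_drop size_cat /r; lia.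
exists r; split=> //; apply: parse_rcons h _ _.
  by split; [split=> //; rewrite er | rewrite -ohead_drop er].
by have := og (size gs); rewrite size_rcons nth_rcons ltnn eqxx; apply.
Qed.

(** ** Gates and formulas at a position *)

(** Gate [m] of the circuit whose code begins at position [s] is [g]. *)
Definition node (s m : nat) (g : gate) : Prop :=
  exists gs r, parse s r (rcons gs g) /\ size gs = m.

Lemma node_inj s m g g' : node s m g -> node s m g' -> g = g'.
Proof.
move=> [gs [r [h <-]]] [gs' [r' [h' e]]].
have [] := parse_inj h h'; first by rewrite !size_rcons e.
by move=> /rcons_inj[].
Qed.

Lemma node_le s m g : node s m g -> s <= n /\ m <= n.
Proof.
move=> [gs [r [h <-]]]; have [] := parse_le h; rewrite size_rcons; lia.
Qed.

Lemma node_ordered s m g : node s m g -> gate_ordered m g.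
Proof.
move=> [gs [r [h <-]]].
by have := parse_ordered h (m := size gs); rewrite size_rcons nth_rcons ltnn eqxx; apply.
Qed.

Lemma parse_node s p gs m : parse s p gs -> m < size gs ->
  node s m (nth (GConst false) gs m).
Proof.
move=> h ltm; have [p' h'] := parse_take h ltm.
exists (take m gs), p'; rewrite -take_nth //; split=> //.
by rewrite size_takel // ltnW.
Qed.

(** The formula of gate [m] of the circuit whose code begins at position [s]. *)
Inductive den (s : nat) : nat -> term -> Prop :=
| den_input m i : node s m (GInput i) -> den s m (Var i)
| den_const m b : node s m (GConst b) -> den s m (Cst b)
| den_not m i f : node s m (GNot i) -> den s i f -> den s m (Neg f)
| den_op o m i j f g : node s m (GOp o i j) -> den s i f -> den s j g ->
    den s m (Op o f g).

Lemma den_node s m f : den s m f -> match f with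
  | Var i => node s m (GInput i)
  | Cst b => node s m (GConst b)
  | Neg f => exists2 i, node s m (GNot i) & den s i f
  | Or f g => exists i j, [/\ node s m (GOp true i j), den s i f & den s j g]
  | And f g => exists i j, [/\ node s m (GOp false i j), den s i f & den s j g]
  end.
Proof.
case=> // [{}m i {}f nm d|[] {}m i j {}f g nm d1 d2]; first by exists i.
- by exists i, j.
- by exists i, j.
Qed.

Lemma den_Op s m o f g : den s m (Op o f g) ->
  exists i j, [/\ node s m (GOp o i j), den s i f & den s j g].
Proof. by case: o => /den_node. Qed.

Lemma den_inj s m f f' : den s m f -> den s m f' -> f = f'.
Proof.
move=> d; elim: d f' =>
  {m f} [m i nm|m b nm|m i f nm _ IH|o m i j f g nm _ IH1 _ IH2] f'.
- case: f' => [i'|b|f'|f1 f2|f1 f2] /den_node; first by move=> /(node_inj nm)[->].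
  + by move=> /(node_inj nm).
  + by case=> ? /(node_inj nm).
  + by case=> ? [? [/(node_inj nm)]].
  + by case=> ? [? [/(node_inj nm)]].
- case: f' => [i'|b'|f'|f1 f2|f1 f2] /den_node; first by move=> /(node_inj nm).
  + by move=> /(node_inj nm)[->].
  + by case=> ? /(node_inj nm).
  + by case=> ? [? [/(node_inj nm)]].
  + by case=> ? [? [/(node_inj nm)]].
- case: f' => [i'|b'|f'|f1 f2|f1 f2] /den_node; first by move=> /(node_inj nm).
  + by move=> /(node_inj nm).
  + by case=> i' /(node_inj nm)[<-] /IH ->.
  + by case=> ? [? [/(node_inj nm)]].
  + by case=> ? [? [/(node_inj nm)]].
- case: o nm => nm; case: f' => [i'|b'|f'|f1 f2|f1 f2] /den_node;
    do ?[by move=> /(node_inj nm)|by case=> ? /(node_inj nm)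
        |by case=> ? [? [/(node_inj nm)]]].
  + by case=> ? [? [/(node_inj nm)[<- <-] /IH1 -> /IH2 ->]].
  + by case=> ? [? [/(node_inj nm)[<- <-] /IH1 -> /IH2 ->]].
Qed.

Lemma parse_den s p gs m : parse s p gs -> m < size gs ->
  den s m (nth (Cst false) (unwind gs) m).
Proof.
move=> h; elim: h m => {p gs} // p r gs g h IH sh og m.
rewrite size_rcons ltnS unwind_rcons nth_rcons size_unwind.
case: ltngtP => // [ltm _|-> _]; first exact: IH.
have nm : node s (size gs) g.
  by exists gs, r; split=> //; apply: parse_rcons h sh og.
case: g sh og nm => [i|b|i|i j|i j] sh /= og nm.
- exact: den_input.
- exact: den_const.
- by apply: den_not nm (IH _ og).
- case/andP: og => ltij ltj.
  exact: (den_op (o := true)) nm (IH _ (ltn_trans ltij ltj)) (IH _ ltj).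
- case/andP: og => ltij ltj.
  exact: (den_op (o := false)) nm (IH _ (ltn_trans ltij ltj)) (IH _ ltj).
Qed.

Lemma den_le s m f : den s m f -> s <= n /\ m <= n.
Proof. by case=> [{}m i|{}m b|{}m i {}f|o {}m i j {}f g] /node_le. Qed.

End Reading.

(** * Rules for pairs of circuits *)

(** The kinds of gates, as in [Op] for the last one. *)
Inductive kind : Type := KInput | KConst of bool | KNot | KOp of bool.

(** The facts of the rules below; their arguments are explained by
    [meaning]. *)
Inductive tag : Type :=
| Accept | Num | Bin | Str | Pre | Wire | Upto | Same | Inst | Near
| Shape of kind | Node of kind.

Definition kind_code (k : kind) : nat :=
  match k with
  | KInput => 0 | KConst b => 1 + b | KNot => 3 | KOp o => 4 + o
  end.

Definition tag_code (t : tag) : nat :=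
  match t with
  | Accept => 0 | Num => 1 | Bin => 2 | Str => 3 | Pre => 4 | Wire => 5
  | Upto => 6 | Same => 7 | Inst => 8 | Near => 9
  | Shape k => 10 + kind_code k | Node k => 16 + kind_code k
  end.

Lemma tag_code_inj : injective tag_code.
Proof.
by case=> [||||||||||[|[]||[]]|[|[]||[]]] [||||||||||[|[]||[]]|[|[]||[]]].
Qed.

Lemma tag_code_lt t : tag_code t < 22.
Proof. by case: t => [||||||||||[|[]||[]]|[|[]||[]]]. Qed.

Section RuleList.

Local Notation v := EVar.
Local Notation Z := (ECst 0).
Local Notation Succ a := (EAdd a (ECst 1)).
Local Notation fact := (@Fact symbol tag tag_code).
Local Notation at_ c a := (FScan (pred1 (Some c)) a).
Local Notation delim a := (FScan delimiter a).
Local Notation lt := (@FLt symbol).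
Local Notation true_ := (@FTrue symbol).
Local Notation "A &&& B" := (FAnd A B) (at level 40, left associativity).

Definition num_nil := Rule 1 Num (v 1) (v 1) Z Z true_.

(** The side condition excludes superfluous zeros, as 0 is denoted by the empty
    string. *)
Definition num_cons b :=
  let p := v 1 in let q := v 2 in let x := v 3 in
  let y := EAdd (EAdd x x) (ECst (nat_of_bool b)) in
  Rule 3 Num p q y Z (at_ (SBit b) p &&& fact Num (Succ p) q x Z &&& lt Z y).

Definition bin_nil := Rule 1 Bin (v 1) (v 1) Z Z true_.

(** Numbers are not bounded by the length of the word if they are names of
    inputs, and are then represented by their segments only.  A first bit 0 must
    be followed by another bit. *)
Definition bin_cons b :=
  let p := v 1 in let q := v 2 in
  Rule 2 Bin p q Z Z
    (at_ (SBit b) p &&& fact Bin (Succ p) q Z Z &&&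
     if b then true_ else lt (Succ p) q).

Definition str_nil := Rule 2 Str (v 1) (v 1) (v 2) (v 2) true_.

Definition str_cons b :=
  let p := v 1 in let q := v 2 in let p' := v 3 in let q' := v 4 in
  Rule 4 Str p q p' q'
    (at_ (SBit b) p &&& at_ (SBit b) p' &&&
     fact Str (Succ p) q (Succ p') q').

Definition shape_input :=
  let p := v 1 in let r := v 2 in
  Rule 2 (Shape KInput) p r (Succ p) r
    (at_ SInput p &&& fact Bin (Succ p) r Z Z &&& delim r).

Definition shape_const b :=
  let p := v 1 in
  Rule 1 (Shape (KConst b)) p (Succ p) Z Z
    (at_ (SConst b) p &&& delim (Succ p)).

Definition shape_not :=
  let p := v 1 in let r := v 2 in let i := v 3 in
  Rule 3 (Shape KNot) p r i Z
    (at_ SNot p &&& fact Num (Succ p) r i Z &&& delim r).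

Definition shape_op o :=
  let p := v 1 in let q := v 2 in let r := v 3 in let i := v 4 in let j := v 5 in
  Rule 5 (Shape (KOp o)) p r i j
    (at_ (op_symbol o) p &&& fact Num (Succ p) q i Z &&& at_ SComma q &&&
     fact Num (Succ q) r j Z &&& delim r).

(** [gate_ordered] for gate [m], of kind [k] with arguments [i] and [j]. *)
Definition ordered_form (k : kind) (i j m : expr) : form symbol :=
  match k with
  | KInput | KConst _ => true_
  | KNot => lt i m
  | KOp _ => lt i j &&& lt j m
  end.

Definition pre_nil := Rule 1 Pre (v 1) (v 1) Z Z true_.

Definition pre_cons k :=
  let s := v 1 in let p := v 2 in let m := v 3 in let r := v 4 in
  let i := v 5 in let j := v 6 in
  Rule 6 Pre s r (Succ m) Z
    (fact Pre s p m Z &&& fact (Shape k) p r i j &&& ordered_form k i j m).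

Definition node_rule k :=
  let s := v 1 in let p := v 2 in let m := v 3 in let r := v 4 in
  let i := v 5 in let j := v 6 in
  Rule 6 (Node k) s m i j
    (fact Pre s p m Z &&& fact (Shape k) p r i j &&& ordered_form k i j m).

Definition wire_not :=
  let s := v 1 in let m := v 2 in let i := v 3 in
  Rule 3 Wire s m i Z (fact (Node KNot) s m i Z).

Definition wire_left o :=
  let s := v 1 in let m := v 2 in let i := v 3 in let j := v 4 in
  Rule 4 Wire s m i Z (fact (Node (KOp o)) s m i j).

Definition wire_right o :=
  let s := v 1 in let m := v 2 in let i := v 3 in let j := v 4 in
  Rule 4 Wire s m j Z (fact (Node (KOp o)) s m i j).

Definition upto_nil := Rule 2 Upto (v 1) Z (v 2) Z true_.

Definition upto_cons :=
  let s := v 1 in let i := v 2 in let l := v 3 in let m := v 4 in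
  Rule 4 Upto s (Succ i) l Z
    (fact Upto s i l Z &&& fact Wire s m i Z &&& lt m l).

Definition same_input :=
  let s := v 1 in let i := v 2 in let t := v 3 in let j := v 4 in
  let p := v 5 in let q := v 6 in let p' := v 7 in let q' := v 8 in
  Rule 8 Same s i t j
    (fact (Node KInput) s i p q &&& fact (Node KInput) t j p' q' &&&
     fact Str p q p' q').

Definition same_const b :=
  let s := v 1 in let i := v 2 in let t := v 3 in let j := v 4 in
  Rule 4 Same s i t j
    (fact (Node (KConst b)) s i Z Z &&& fact (Node (KConst b)) t j Z Z).

Definition same_not :=
  let s := v 1 in let i := v 2 in let t := v 3 in let j := v 4 in
  let i1 := v 5 in let j1 := v 6 in
  Rule 6 Same s i t j
    (fact (Node KNot) s i i1 Z &&& fact (Node KNot) t j j1 Z &&&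
     fact Same s i1 t j1).

Definition same_op o :=
  let s := v 1 in let i := v 2 in let t := v 3 in let j := v 4 in
  let i1 := v 5 in let i2 := v 6 in let j1 := v 7 in let j2 := v 8 in
  Rule 8 Same s i t j
    (fact (Node (KOp o)) s i i1 i2 &&& fact (Node (KOp o)) t j j1 j2 &&&
     fact Same s i1 t j1 &&& fact Same s i2 t j2).

Definition inst_neg b :=
  let s := v 1 in let i := v 2 in let t := v 3 in let j := v 4 in
  let a := v 5 in
  Rule 5 Inst s i t j
    (fact (Node KNot) s i a Z &&& fact (Node (KConst b)) s a Z Z &&&
     fact (Node (KConst (~~ b))) t j Z Z).

Definition inst_unit o :=
  let s := v 1 in let i := v 2 in let t := v 3 in let j := v 4 in
  let a := v 5 in let b := v 6 in
  Rule 6 Inst s i t j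
    (fact (Node (KOp o)) s i a b &&& fact (Node (KConst (~~ o))) s a Z Z &&&
     fact Same s b t j).

Definition inst_compl o :=
  let s := v 1 in let i := v 2 in let t := v 3 in let j := v 4 in
  let a := v 5 in let b := v 6 in let c := v 7 in
  Rule 7 Inst s i t j
    (fact (Node (KOp o)) s i a b &&& fact (Node KNot) s b c Z &&&
     fact Same s a s c &&& fact (Node (KConst o)) t j Z Z).

Definition inst_comm o :=
  let s := v 1 in let i := v 2 in let t := v 3 in let j := v 4 in
  let a := v 5 in let b := v 6 in let c := v 7 in let d := v 8 in
  Rule 8 Inst s i t j
    (fact (Node (KOp o)) s i a b &&& fact (Node (KOp o)) t j c d &&&
     fact Same s a t d &&& fact Same s b t c).

Definition inst_assoc o :=
  let s := v 1 in let i := v 2 in let t := v 3 in let j := v 4 in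
  let a := v 5 in let b := v 6 in let c := v 7 in let d := v 8 in
  let e := v 9 in let f := v 10 in let g := v 11 in let h := v 12 in
  Rule 12 Inst s i t j
    (fact (Node (KOp o)) s i a b &&& fact (Node (KOp o)) s b c d &&&
     fact (Node (KOp o)) t j e f &&& fact (Node (KOp o)) t e g h &&&
     fact Same s a t g &&& fact Same s c t h &&& fact Same s d t f).

Definition inst_distr o :=
  let s := v 1 in let i := v 2 in let t := v 3 in let j := v 4 in
  let a := v 5 in let b := v 6 in let c := v 7 in let d := v 8 in
  let e := v 9 in let f := v 10 in let g := v 11 in let h := v 12 in
  let k := v 13 in let l := v 14 in
  Rule 14 Inst s i t j
    (fact (Node (KOp o)) s i a b &&& fact (Node (KOp (~~ o))) s b c d &&&
     fact (Node (KOp (~~ o))) t j e f &&& fact (Node (KOp o)) t e g h &&&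
     fact (Node (KOp o)) t f k l &&&
     fact Same s a t g &&& fact Same s c t h &&& fact Same s a t k &&&
     fact Same s d t l).

Definition near_inst :=
  let s := v 1 in let i := v 2 in let t := v 3 in let j := v 4 in
  Rule 4 Near s i t j (fact Inst s i t j).

Definition near_inst_sym :=
  let s := v 1 in let i := v 2 in let t := v 3 in let j := v 4 in
  Rule 4 Near s i t j (fact Inst t j s i).

Definition near_not :=
  let s := v 1 in let i := v 2 in let t := v 3 in let j := v 4 in
  let i1 := v 5 in let j1 := v 6 in
  Rule 6 Near s i t j
    (fact (Node KNot) s i i1 Z &&& fact (Node KNot) t j j1 Z &&&
     fact Near s i1 t j1).

Definition near_left o :=
  let s := v 1 in let i := v 2 in let t := v 3 in let j := v 4 in
  let i1 := v 5 in let i2 := v 6 in let j1 := v 7 in let j2 := v 8 in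
  Rule 8 Near s i t j
    (fact (Node (KOp o)) s i i1 i2 &&& fact (Node (KOp o)) t j j1 j2 &&&
     fact Near s i1 t j1 &&& fact Same s i2 t j2).

Definition near_right o :=
  let s := v 1 in let i := v 2 in let t := v 3 in let j := v 4 in
  let i1 := v 5 in let i2 := v 6 in let j1 := v 7 in let j2 := v 8 in
  Rule 8 Near s i t j
    (fact (Node (KOp o)) s i i1 i2 &&& fact (Node (KOp o)) t j j1 j2 &&&
     fact Same s i1 t j1 &&& fact Near s i2 t j2).

(** The codes of the two circuits begin at positions 0 and [p + 1]; their last
    gates have the indices [i] and [j].  The variables [k] and [l] are
    needed because only numbers up to the length of the word are known to be
    arguments of facts, which [i + 1] and [j + 1] are not by themselves. *)
Definition accept :=
  let p := v 1 in let i := v 2 in let j := v 3 in let k := v 4 in let l := v 5 in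
  Rule 5 Accept Z Z Z Z
    (FEq symbol k (Succ i) &&& FEq symbol l (Succ j) &&&
     fact Pre Z p k Z &&& at_ SSep p &&& fact Pre (Succ p) ELen l Z &&&
     fact Upto Z i k Z &&& fact Upto (Succ p) j l Z &&&
     fact Near Z i (Succ p) j).

Definition for_bools (A : Type) (r : bool -> A) : seq A :=
  [:: r true; r false].

Definition for_kinds (A : Type) (r : kind -> A) : seq A :=
  [:: r KInput, r KNot & for_bools (fun b => r (KConst b)) ++
      for_bools (fun o => r (KOp o))].

Definition rules : seq (rule symbol tag) :=
  flatten [:: [:: num_nil; bin_nil; str_nil; shape_input; shape_not; pre_nil;
    wire_not; upto_nil; upto_cons; same_input; same_not;
    near_inst; near_inst_sym; near_not; accept];
    for_bools num_cons; for_bools bin_cons; for_bools str_cons;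
    for_bools shape_const; for_bools shape_op; for_kinds pre_cons;
    for_kinds node_rule; for_bools wire_left; for_bools wire_right;
    for_bools same_const; for_bools same_op; for_bools inst_neg;
    for_bools inst_unit; for_bools inst_compl; for_bools inst_comm;
    for_bools inst_assoc; for_bools inst_distr; for_bools near_left;
    for_bools near_right].

End RuleList.

(** * Meaning of the facts *)

(** The gate [g] has the kind [k] and the arguments [i] and [j], which for an
    input are the ends of the segment with its name. *)
Definition is_kind (w : seq symbol) (k : kind) (i j : nat) (g : gate) : Prop :=
  match k with
  | KInput => exists2 x, g = GInput x & seg w i j (binary x)
  | KConst b => g = GConst b
  | KNot => g = GNot i
  | KOp o => g = GOp o i j
  end.

(** The problem to be decided. *)
Definition accepted (w : seq symbol) : Prop :=
  exists (n m : nat) (A : circuit n) (B : circuit m),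
    w = encode_pair A B /\ approx A B.

(** The intended interpretation of the facts.  Unused arguments are 0. *)
Definition meaning (w : seq symbol) (t : tag) (b c d e : nat) : Prop :=
  match t with
  | Accept => accepted w
  | Num => seg w b c (binary d)
  | Bin => exists x, seg w b c (binary x)
  | Str => exists x, seg w b c x /\ seg w d e x
  | Pre => exists gs, parse w b c gs /\ size gs = d
  | Wire => exists g, node w b c g /\ d \in wires g
  | Upto => forall i, i < c ->
      exists m g, [/\ m < d, node w b m g & i \in wires g]
  | Same => exists f, den w b c f /\ den w d e f
  | Inst => exists f g, [/\ den w b c f, den w d e g & BA_instance f g]
  | Near => exists f g, [/\ den w b c f, den w d e g & near f g]
  | Shape k => exists g, is_kind w k d e g /\ shape w b c g
  | Node k => exists g, is_kind w k d e g /\ node w b c g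
  end.

Lemma encode_GOp o i j :
  encode_gate (GOp o i j) = op_symbol o :: binary i ++ SComma :: binary j.
Proof. by case: o. Qed.

(** The number of inputs of a circuit is not part of its code; it can be chosen
    large enough. *)
Lemma circuit_exists (gs : seq gate) : 0 < size gs ->
  (forall m, m < size gs -> gate_ordered m (nth (GConst false) gs m)) ->
  (forall j, j < (size gs).-1 -> has (fun g => j \in wires g) gs) ->
  exists n (C : circuit n), gates C = gs.
Proof.
move=> gt0 og used.
have [N NP] : exists N, forall m i, m < size gs ->
    nth (GConst false) gs m = GInput i -> i < N.
  elim: gs {gt0 og used} => [|g gs [N NP]]; first by exists 0.
  exists (maxn N (if g is GInput i then i.+1 else 0)) => -[|m] i /= ltm eg.
    by rewrite eg leq_max leqnn orbT.
  by rewrite leq_max (NP m).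
have wf j : j < size gs -> gate_wf N j (nth (GConst false) gs j).
  by move=> ltj; have := og j ltj; have := NP j; case: nth => //= i h _; apply: h ltj _.
by exists N, (Circuit gt0 wf used).
Qed.

(** * Soundness *)

Section Soundness.
Variable w : seq symbol.
Local Notation n := (size w).
Local Notation sound := (respects tag_code w (meaning w)).

#[local] Opaque Fact.

(** Replace the hypothesis that a fact holds by its meaning. *)
Ltac use h := apply sat_addressed in h; [simpl in h | simpl; lia ..].

Lemma at_lt p c : onth w p = Some c -> p < n.
Proof. by case/onth_drop. Qed.

Lemma sound_num_nil : sound num_nil.
Proof. by move=> a p lep /= _ _ _ _ _; rewrite binary0; apply: seg_nil. Qed.

Lemma sound_num_cons b : sound (num_cons b).
Proof.
move=> a /= p lep q leq x lex [[/eqP ep h] gt0] _ _ _ _.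
have ltp := at_lt ep; use h; rewrite addn1 in h.
by rewrite addnn binary_double; [apply/seg_cons | rewrite -addnn; lia].
Qed.

Lemma sound_bin_nil : sound bin_nil.
Proof. by move=> a p lep /= _ _ _ _ _; exists 0; rewrite binary0; apply: seg_nil. Qed.

Lemma sound_bin_cons b : sound (bin_cons b).
Proof.
move=> a /= p lep q leq [[/eqP ep h] c] _ _ _ _.
have ltp := at_lt ep; use h; case: h => x; rewrite addn1 => h.
exists (x.*2 + b); rewrite binary_double; first by apply/seg_cons.
case: b {ep} c => /=; first by rewrite addn1.
have := seg_size h; case: (posnP x) => [->|]; first by rewrite binary0 /=; lia.
by rewrite addn0 double_gt0.
Qed.

Lemma sound_str_nil : sound str_nil.
Proof. by move=> a /= p lep q leq _ _ _ _ _; exists [::]; split; apply: seg_nil. Qed.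

Lemma sound_str_cons b : sound (str_cons b).
Proof.
move=> a /= p lep q leq p' lep' q' leq' [[/eqP ep /eqP ep'] h] _ _ _ _.
have ltp := at_lt ep; have ltp' := at_lt ep'; use h.
case: h => x; rewrite !addn1 => -[s s'].
by exists (SBit b :: x); split; apply/seg_cons.
Qed.

Lemma sound_shape_input : sound shape_input.
Proof.
move=> a /= p lep r ler [[/eqP ep h] dr] _ _ _ _.
have ltp := at_lt ep; use h; case: h => x; rewrite addn1 => s.
exists (GInput x); split; first by exists x.
by split=> //; apply/seg_cons.
Qed.

Lemma sound_shape_const b : sound (shape_const b).
Proof.
move=> a /= p lep [/eqP ep dr] _ _ _ _; have ltp := at_lt ep.
exists (GConst b); split=> //; split=> //; rewrite addn1.
by apply/seg_cons; split=> //; apply: seg_nil.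
Qed.

Lemma sound_shape_not : sound shape_not.
Proof.
move=> a /= p lep r ler i lei [[/eqP ep h] dr] _ _ _ _.
have ltp := at_lt ep; use h; rewrite addn1 in h.
by exists (GNot i); split=> //; split=> //; apply/seg_cons.
Qed.

Lemma sound_shape_op o : sound (shape_op o).
Proof.
move=> a /= p lep q leq r ler i lei j lej [[[[/eqP ep h] /eqP eq] h'] dr] _ _ _ _.
have ltp := at_lt ep; have ltq := at_lt eq; use h; use h'.
rewrite !addn1 in h h'; exists (GOp o i j); split=> //; split=> //.
rewrite encode_GOp; apply/seg_cons; split=> //.
by apply/seg_cat; exists q; split=> //; apply/seg_cons.
Qed.

Lemma ordered_formP X e k i j m g : is_kind w k (eval n e i) (eval n e j) g ->
  sat w X e (ordered_form k i j m) <-> gate_ordered (eval n e m) g.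
Proof.
case: k => [[x -> _]|b ->|->|[] ->] //=; rewrite ?addn1 //.
all: by split=> [[-> ->]|/andP].
Qed.

Lemma sound_pre_nil : sound pre_nil.
Proof. by move=> a /= s les _ _ _ _ _; exists [::]; split=> //; apply: parse_nil. Qed.

Lemma sound_pre_cons k : sound (pre_cons k).
Proof.
move=> a /= s les p lep m lem r ler i lei j lej [[h1 h2] og] _ _ _ _.
use h1; use h2; case: h1 h2 => gs [ps em] [g [kg sh]].
have {}og : gate_ordered m g :=
  (@ordered_formP _ [:: a; s; p; m; r; i; j] k (EVar 5) (EVar 6) (EVar 3) g kg).1 og.
exists (rcons gs g); rewrite size_rcons em addn1; split=> //.
by apply: parse_rcons ps sh _; rewrite em.
Qed.

Lemma sound_node_rule k : sound (node_rule k).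
Proof.
move=> a /= s les p lep m lem r ler i lei j lej [[h1 h2] og] _ _ _ _.
use h1; use h2; case: h1 h2 => gs [ps em] [g [kg sh]].
have {}og : gate_ordered m g :=
  (@ordered_formP _ [:: a; s; p; m; r; i; j] k (EVar 5) (EVar 6) (EVar 3) g kg).1 og.
exists g; split=> //; exists gs, r; split=> //.
by apply: parse_rcons ps sh _; rewrite em.
Qed.

Lemma sound_wire_not : sound wire_not.
Proof.
move=> a /= s les m lem i lei h _ _ _ _; use h.
by case: h => g [-> nm]; exists (GNot i); rewrite mem_seq1.
Qed.

Lemma wires_GOp o i j : wires (GOp o i j) = [:: i; j].
Proof. by case: o. Qed.

Lemma sound_wire_left o : sound (wire_left o).
Proof.
move=> a /= s les m lem i lei j lej h _ _ _ _; use h.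
by case: h => g [-> nm]; exists (GOp o i j); rewrite wires_GOp mem_head.
Qed.

Lemma sound_wire_right o : sound (wire_right o).
Proof.
move=> a /= s les m lem i lei j lej h _ _ _ _; use h.
by case: h => g [-> nm]; exists (GOp o i j); rewrite wires_GOp inE mem_head orbT.
Qed.

Lemma sound_upto_nil : sound upto_nil.
Proof. by []. Qed.

Lemma sound_upto_cons : sound upto_cons.
Proof.
move=> a /= s les i lei l lel m lem [[h1 h2] ltm] _ _ _ _.
use h1; use h2; move=> i'; rewrite addn1 ltnS leq_eqVlt => /predU1P[->|/h1 //].
by case: h2 => g [nm ig]; exists m, g; split=> //; lia.
Qed.

Lemma sound_same_input : sound same_input.
Proof.
move=> a /= s les i lei t let_ j lej p lep q leq p' lep' q' leq' [[h1 h2] h3] _ _ _ _.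
use h1; use h2; use h3; case: h3 => x [sx sx'].
case: h1 => g [[y -> sy] ni]; case: h2 => g' [[z -> sz] nj].
(* Canonical binary notation is injective. *)
have eyz : y = z.
  have [] // := @binary_cat_inj y z [::] [::] isT isT.
  by rewrite !cats0 -(seg_inj sx sy) (seg_inj sx' sz).
by exists (Var y); split; [|rewrite eyz]; apply: den_input.
Qed.

Lemma sound_same_const b : sound (same_const b).
Proof.
move=> a /= s les i lei t let_ j lej [h1 h2] _ _ _ _.
use h1; use h2; case: h1 h2 => _ [-> ni] [_ [-> nj]].
by exists (Cst b); split; apply: den_const.
Qed.

Lemma sound_same_not : sound same_not.
Proof.
move=> a /= s les i lei t let_ j lej i1 lei1 j1 lej1 [[h1 h2] h3] _ _ _ _.
use h1; use h2; use h3; case: h1 h2 h3 => _ [-> ni] [_ [-> nj]] [f [di dj]].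
by exists (Neg f); split; [apply: den_not ni di | apply: den_not nj dj].
Qed.

Lemma sound_same_op o : sound (same_op o).
Proof.
move=> a /= s les i lei t let_ j lej i1 lei1 i2 lei2 j1 lej1 j2 lej2.
move=> [[[h1 h2] h3] h4] _ _ _ _; use h1; use h2; use h3; use h4.
case: h1 h2 h3 h4 => _ [-> ni] [_ [-> nj]] [f [df df']] [g [dg dg']].
exists (Op o f g).
by split; [apply: den_op ni df dg | apply: den_op nj df' dg'].
Qed.

Lemma sound_inst_neg b : sound (inst_neg b).
Proof.
move=> a0 /= s les i lei t let_ j lej a lea [[h1 h2] h3] _ _ _ _.
use h1; use h2; use h3; case: h1 h2 h3 => _ [-> ni] [_ [-> na]] [_ [-> nj]].
exists (Neg (Cst b)), (Cst (~~ b)); split; last exact: BAi_neg.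
- by apply: den_not ni _; apply: den_const.
- exact: den_const.
Qed.

Lemma sound_inst_unit o : sound (inst_unit o).
Proof.
move=> a0 /= s les i lei t let_ j lej a lea b leb [[h1 h2] h3] _ _ _ _.
use h1; use h2; use h3; case: h1 h2 h3 => _ [-> ni] [_ [-> na]] [f [df df']].
exists (Op o (Cst (~~ o)) f), f; split=> //; last exact: BAi_unit.
by apply: den_op ni _ df; apply: den_const.
Qed.

Lemma sound_inst_compl o : sound (inst_compl o).
Proof.
move=> a0 /= s les i lei t let_ j lej a lea b leb c lec [[[h1 h2] h3] h4] _ _ _ _.
use h1; use h2; use h3; use h4.
case: h1 h2 h3 h4 => _ [-> ni] [_ [-> nb]] [f [da dc]] [_ [-> nj]].
exists (Op o f (Neg f)), (Cst o); split; last exact: BAi_compl.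
- by apply: den_op ni da _; apply: den_not nb dc.
- exact: den_const.
Qed.

Lemma sound_inst_comm o : sound (inst_comm o).
Proof.
move=> a0 /= s les i lei t let_ j lej a lea b leb c lec d led.
move=> [[[h1 h2] h3] h4] _ _ _ _; use h1; use h2; use h3; use h4.
case: h1 h2 h3 h4 => _ [-> ni] [_ [-> nj]] [f [df df']] [g [dg dg']].
exists (Op o f g), (Op o g f); split; last exact: BAi_comm.
- exact: den_op ni df dg.
- exact: den_op nj dg' df'.
Qed.

Lemma sound_inst_assoc o : sound (inst_assoc o).
Proof.
move=> a0 /= s les i lei t let_ j lej a lea b leb c lec d led e lee f lef g leg h leh.
move=> [[[[[[h1 h2] h3] h4] h5] h6] h7] _ _ _ _.
use h1; use h2; use h3; use h4; use h5; use h6; use h7.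
case: h1 h2 h3 h4 => _ [-> ni] [_ [-> nb]] [_ [-> nj]] [_ [-> ne]].
case: h5 h6 h7 => A [dA dA'] [B [dB dB']] [C [dC dC']].
exists (Op o A (Op o B C)), (Op o (Op o A B) C); split; last exact: BAi_assoc.
- exact: den_op ni dA (den_op nb dB dC).
- exact: den_op nj (den_op ne dA' dB') dC'.
Qed.

Lemma sound_inst_distr o : sound (inst_distr o).
Proof.
move=> a0 /= s les i lei t let_ j lej a lea b leb c lec d led e lee f lef g leg h leh.
move=> k lek l lel [[[[[[[[h1 h2] h3] h4] h5] h6] h7] h8] h9] _ _ _ _.
use h1; use h2; use h3; use h4; use h5; use h6; use h7; use h8; use h9.
case: h1 h2 h3 h4 h5 => _ [-> ni] [_ [-> nb]] [_ [-> nj]] [_ [-> ne]] [_ [-> nf]].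
case: h6 h7 h8 h9 => A [dA dA'] [B [dB dB']] [A2 [dA2 dA2']] [C [dC dC']].
(* Both occurrences of the first operand on the right have the formula of
   gate [a]. *)
rewrite -(den_inj dA dA2) in dA2'.
exists (Op o A (Op (~~ o) B C)), (Op (~~ o) (Op o A B) (Op o A C)).
split; last exact: BAi_distr.
- exact: den_op ni dA (den_op nb dB dC).
- exact: den_op nj (den_op ne dA' dB') (den_op nf dA2' dC').
Qed.

Lemma sound_near_inst : sound near_inst.
Proof.
move=> a /= s les i lei t let_ j lej h _ _ _ _; use h.
by case: h => f [g [df dg fg]]; exists f, g; split=> //; apply: near_BA.
Qed.

Lemma sound_near_inst_sym : sound near_inst_sym.
Proof.
move=> a /= s les i lei t let_ j lej h _ _ _ _; use h.
by case: h => f [g [df dg fg]]; exists g, f; split=> //; apply: near_AB.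
Qed.

Lemma sound_near_not : sound near_not.
Proof.
move=> a /= s les i lei t let_ j lej i1 lei1 j1 lej1 [[h1 h2] h3] _ _ _ _.
use h1; use h2; use h3; case: h1 h2 h3 => _ [-> ni] [_ [-> nj]] [f [g [df dg fg]]].
exists (Neg f), (Neg g); split; last exact: near_neg.
- exact: den_not ni df.
- exact: den_not nj dg.
Qed.

Lemma sound_near_left o : sound (near_left o).
Proof.
move=> a /= s les i lei t let_ j lej i1 lei1 i2 lei2 j1 lej1 j2 lej2.
move=> [[[h1 h2] h3] h4] _ _ _ _; use h1; use h2; use h3; use h4.
case: h1 h2 h3 h4 => _ [-> ni] [_ [-> nj]] [f [g [df dg fg]]] [h [dh dh']].
exists (Op o f h), (Op o g h); split; last exact: near_opl.
- exact: den_op ni df dh.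
- exact: den_op nj dg dh'.
Qed.

Lemma sound_near_right o : sound (near_right o).
Proof.
move=> a /= s les i lei t let_ j lej i1 lei1 i2 lei2 j1 lej1 j2 lej2.
move=> [[[h1 h2] h3] h4] _ _ _ _; use h1; use h2; use h3; use h4.
case: h1 h2 h3 h4 => _ [-> ni] [_ [-> nj]] [h [dh dh']] [f [g [df dg fg]]].
exists (Op o h f), (Op o h g); split; last exact: near_opr.
- exact: den_op ni dh df.
- exact: den_op nj dh' dg.
Qed.

(** The gates read from position [s] form a circuit if all but the last are
    used. *)
Lemma parse_circuit s p gs i : parse w s p gs -> size gs = i.+1 ->
  meaning w Upto s i i.+1 0 -> exists m (C : circuit m),
    gates C = gs /\ den w s i (Fla C).
Proof.
move=> ps sz used; have [||m [C eC]] := @circuit_exists gs _ (parse_ordered ps).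
- by rewrite sz.
- move=> j; rewrite sz => /used[k [g [ltk nk jg]]].
  apply/(has_nthP (GConst false)); exists k; first by rewrite sz.
  by rewrite (node_inj (parse_node ps _) nk) // sz.
exists m, C; split=> //; rewrite Fla_nth eC sz.
by apply: parse_den ps _; rewrite sz.
Qed.

Lemma sound_accept : sound accept.
Proof.
move=> a /= p lep i lei j lej k lek l lel.
move=> [[[[[[[[k1 k2] [l1 l2]] h1] /eqP ep] h2] h3] h4] h5] _ _ _ _.
have ltp := at_lt ep; use h1; use h2; use h3; use h4; use h5.
have ek : k = i.+1 by lia.
have el : l = j.+1 by lia.
case: h1 h2 => gs [ps szg] [hs [ph szh]]; rewrite ek in szg h3; rewrite el in szh h4.
rewrite addn1 in ph h4 h5.
have [n1 [A [eA dA]]] := parse_circuit ps szg h3.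
have [n2 [B [eB dB]]] := parse_circuit ph szh h4.
exists n1, n2, A, B; split.
  have := parse_drop ps; rewrite drop0 => ->.
  have [_ ->] := (onth_drop w p SSep).1 ep.
  by rewrite (parse_drop ph) drop_size cats0 /encode_pair eA eB.
case: h5 => f [g [df dg fg]].
by apply/simBA_near; rewrite (den_inj dA df) (den_inj dB dg).
Qed.

Lemma in_flatten (A : Type) (x : A) l ls :
  List.In x (flatten (l :: ls)) -> List.In x l \/ List.In x (flatten ls).
Proof.
rewrite /=; elim: l => [|y l IH] /=; first by right.
by case=> [->|/IH[]]; [left; left|left; right|right].
Qed.

Lemma bools_sound (r : bool -> rule symbol tag) :
  (forall b, sound (r b)) -> forall x, List.In x (for_bools r) -> sound x.
Proof. by move=> rP x [<-|[<-|[]]]. Qed.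

Lemma kinds_sound (r : kind -> rule symbol tag) :
  (forall k, sound (r k)) -> forall x, List.In x (for_kinds r) -> sound x.
Proof. by move=> rP x [<-|[<-|[<-|[<-|[<-|[<-|[]]]]]]]. Qed.

Lemma rules_sound x : List.In x rules -> sound x.
Proof.
rewrite /rules; move/(@in_flatten _ x) => [|].
  case=> [<-|]; first exact: sound_num_nil.
  case=> [<-|]; first exact: sound_bin_nil.
  case=> [<-|]; first exact: sound_str_nil.
  case=> [<-|]; first exact: sound_shape_input.
  case=> [<-|]; first exact: sound_shape_not.
  case=> [<-|]; first exact: sound_pre_nil.
  case=> [<-|]; first exact: sound_wire_not.
  case=> [<-|]; first exact: sound_upto_nil.
  case=> [<-|]; first exact: sound_upto_cons.
  case=> [<-|]; first exact: sound_same_input.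
  case=> [<-|]; first exact: sound_same_not.
  case=> [<-|]; first exact: sound_near_inst.
  case=> [<-|]; first exact: sound_near_inst_sym.
  case=> [<-|]; first exact: sound_near_not.
  case=> [<-|]; first exact: sound_accept.
  by [].
move/(@in_flatten _ x) => [|]; first exact: bools_sound sound_num_cons x.
move/(@in_flatten _ x) => [|]; first exact: bools_sound sound_bin_cons x.
move/(@in_flatten _ x) => [|]; first exact: bools_sound sound_str_cons x.
move/(@in_flatten _ x) => [|]; first exact: bools_sound sound_shape_const x.
move/(@in_flatten _ x) => [|]; first exact: bools_sound sound_shape_op x.
move/(@in_flatten _ x) => [|]; first exact: kinds_sound sound_pre_cons x.
move/(@in_flatten _ x) => [|]; first exact: kinds_sound sound_node_rule x.
move/(@in_flatten _ x) => [|]; first exact: bools_sound sound_wire_left x.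
move/(@in_flatten _ x) => [|]; first exact: bools_sound sound_wire_right x.
move/(@in_flatten _ x) => [|]; first exact: bools_sound sound_same_const x.
move/(@in_flatten _ x) => [|]; first exact: bools_sound sound_same_op x.
move/(@in_flatten _ x) => [|]; first exact: bools_sound sound_inst_neg x.
move/(@in_flatten _ x) => [|]; first exact: bools_sound sound_inst_unit x.
move/(@in_flatten _ x) => [|]; first exact: bools_sound sound_inst_compl x.
move/(@in_flatten _ x) => [|]; first exact: bools_sound sound_inst_comm x.
move/(@in_flatten _ x) => [|]; first exact: bools_sound sound_inst_assoc x.
move/(@in_flatten _ x) => [|]; first exact: bools_sound sound_inst_distr x.
move/(@in_flatten _ x) => [|]; first exact: bools_sound sound_near_left x.
move/(@in_flatten _ x) => [|]; first exact: bools_sound sound_near_right x.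
by [].
Qed.

End Soundness.

(** * Completeness *)

Section Completeness.
Variables (w : seq symbol) (X : nat -> Prop).
Local Notation n := (size w).
Hypothesis clX : form_closed (EBound 22) (rules_form tag_code rules) w X.
Local Notation has := (fun t b c d e => X (addr tag_code n t b c d e)).
#[local] Opaque Fact addr.

Ltac find_rule := rewrite /rules /=; repeat first [left; reflexivity | right].

Ltac solve_body :=
  repeat split; rewrite ?sat_fact /= ?addn1;
  first [assumption | by apply/eqP | lia | idtac].

(** Derive a fact by the rule in [h], where [l] are the values of its
    variables. *)
Ltac by_rule_in h l :=
  apply: (closed_derive tag_code_lt (xs := l) clX h) => /=;
  [by [] | lia | by split; lia | by split; lia | solve_body].

Ltac by_rule r l :=
  let h := fresh in
  have h : List.In r rules; [by find_rule | by_rule_in h l; clear h].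

Ltac by_bool_rule r b l :=
  let h := fresh in
  have h : List.In (r b) rules; [by case: (b); find_rule | by_rule_in h l; clear h].

Ltac by_kind_rule r k l :=
  let h := fresh in
  have h : List.In (r k) rules;
    [by case: (k) => [|[]||[]]; find_rule | by_rule_in h l; clear h].

(** Here and below: a fact whose meaning is true belongs to the closed set. *)
Lemma has_num x p q : seg w p q (binary x) -> x <= n -> has Num p q x 0.
Proof.
elim/ltn_ind: x p => x IH p; case: (posnP x) => [->|gt0].
  rewrite binary0 => /[dup] /seg_size /=; rewrite addn0 => -> /seg_le[lep _] _.
  by by_rule num_nil [:: p].
rewrite binaryS // => /seg_cons[ep s] lex; have ltp := at_lt ep.
have [_ leq] := seg_le s.
have h : has Num p.+1 q x./2 0 by apply: IH s _; lia.
have ex : x = x./2.*2 + odd x by rewrite addnC odd_double_half.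
rewrite ex; move: (odd x) ex ep => b ex ep.
by by_bool_rule num_cons b [:: p; q; x./2].
Qed.

Lemma has_bin x p q : seg w p q (binary x) -> has Bin p q 0 0.
Proof.
elim/ltn_ind: x p => x IH p; case: (posnP x) => [->|gt0].
  rewrite binary0 => /[dup] /seg_size /=; rewrite addn0 => -> /seg_le[lep _].
  by by_rule bin_nil [:: p].
rewrite binaryS // => /seg_cons[ep s]; have ltp := at_lt ep.
have [_ leq] := seg_le s.
have h : has Bin p.+1 q 0 0 by apply: IH s; lia.
have c : odd x || (p.+1 < q).
  case ox: (odd x) => //=; rewrite (seg_size s).
  have x2 : 0 < x./2 by rewrite -[x]odd_double_half ox in gt0; lia.
  by rewrite binaryS //=; lia.
move: (odd x) ep c => b ep c.
by by_bool_rule bin_cons b [:: p; q]; case: b c {ep}; rewrite /= ?addn1.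
Qed.

Lemma has_str bs p q p' q' : seg w p q [seq SBit b | b <- bs] ->
  seg w p' q' [seq SBit b | b <- bs] -> has Str p q p' q'.
Proof.
elim: bs p p' => [|b bs IH] p p' /=.
  move=> /[dup] /seg_size /=; rewrite addn0 => -> /seg_le[lep _].
  move=> /[dup] /seg_size /=; rewrite addn0 => -> /seg_le[lep' _].
  by by_rule str_nil [:: p; p'].
move=> /seg_cons[ep s] /seg_cons[ep' s']; have h := IH _ _ s s'.
have ltp := at_lt ep; have ltp' := at_lt ep'.
have [_ leq] := seg_le s; have [_ leq'] := seg_le s'.
by by_bool_rule str_cons b [:: p; q; p'; q'].
Qed.

Definition gate_kind (g : gate) : kind :=
  match g with
  | GInput _ => KInput
  | GConst b => KConst b
  | GNot _ => KNot
  | GOr _ _ => KOp true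
  | GAnd _ _ => KOp false
  end.

(** The arguments of the gate [g] with code from [p] to [r], as in [is_kind]. *)
Definition gate_args (g : gate) (p r : nat) : nat * nat :=
  match g with
  | GInput _ => (p.+1, r)
  | GConst _ => (0, 0)
  | GNot i => (i, 0)
  | GOr i j | GAnd i j => (i, j)
  end.

Lemma gate_kindP p r g : shape w p r g ->
  is_kind w (gate_kind g) (gate_args g p r).1 (gate_args g p r).2 g.
Proof. by case: g => //= x [/seg_cons[_ s] _]; exists x. Qed.

Lemma has_shape_op o p r i j : i <= n -> j <= n -> shape w p r (GOp o i j) ->
  has (Shape (KOp o)) p r i j.
Proof.
move=> lei lej [+ dr]; rewrite encode_GOp => /seg_cons[ep /seg_cat[q [s]]].
case/seg_cons=> eq s'; have ltp := at_lt ep; have ltq := at_lt eq.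
have [_ ler] := seg_le s'.
have h := has_num s lei; have h' := has_num s' lej.
by by_bool_rule shape_op o [:: p; q; r; i; j].
Qed.

Lemma has_shape p r g m : shape w p r g -> gate_ordered m g -> m <= n ->
  has (Shape (gate_kind g)) p r (gate_args g p r).1 (gate_args g p r).2.
Proof.
case: g => [x|b|i|i j|i j] /=.
- move=> [/seg_cons[ep s] dr] _ _; have ltp := at_lt ep.
  have [_ ler] := seg_le s; have h := has_bin s.
  by by_rule shape_input [:: p; r].
- move=> [/seg_cons[ep s] dr] _ _; have ltp := at_lt ep.
  have er := seg_size s; rewrite addn0 in er; rewrite er in dr *.
  by by_bool_rule shape_const b [:: p].
- move=> [/seg_cons[ep s] dr] ltm lem; have ltp := at_lt ep.
  have [_ ler] := seg_le s.
  have lei : i <= n by lia.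
  have h := has_num s lei.
  by by_rule shape_not [:: p; r; i].
- by move=> sh /andP[ltij ltj] lem; apply: (@has_shape_op true) sh; lia.
- by move=> sh /andP[ltij ltj] lem; apply: (@has_shape_op false) sh; lia.
Qed.

Lemma gate_args_le p r g m : shape w p r g -> gate_ordered m g -> m <= n ->
  (gate_args g p r).1 <= n /\ (gate_args g p r).2 <= n.
Proof.
case: g => [x|b|i|i j|i j] /=; try by move=> *; lia.
by case=> /seg_cons[_ /seg_le].
Qed.

Lemma ordered_args e p r g a b m :
  shape w p r g -> eval n e a = (gate_args g p r).1 ->
  eval n e b = (gate_args g p r).2 -> gate_ordered (eval n e m) g ->
  sat w X e (ordered_form (gate_kind g) a b m).
Proof.
move=> sh ea eb og; apply/(@ordered_formP w X e (gate_kind g) a b m g) => //.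
by rewrite ea eb; apply: gate_kindP.
Qed.

Lemma has_pre s p gs : parse w s p gs -> has Pre s p (size gs) 0.
Proof.
elim=> {p gs} [les|p r gs g ps IH sh og].
  by by_rule pre_nil [:: s].
have [le1 le2] := parse_le ps; have ltp := shape_gt0 sh.
have ler : r <= n by case: sh => /seg_le[].
have lem : size gs <= n by lia.
have h := has_shape sh og lem; have [l1 l2] := gate_args_le sh og lem.
rewrite size_rcons.
by_kind_rule pre_cons (gate_kind g)
  [:: s; p; size gs; r; (gate_args g p r).1; (gate_args g p r).2].
exact: ordered_args sh _ _ _.
Qed.

Lemma has_node s m g : node w s m g -> exists p r, shape w p r g /\
  has (Node (gate_kind g)) s m (gate_args g p r).1 (gate_args g p r).2.
Proof.
case=> gs [r [pr <-]].
have [p [ps sh og]] := parse_rconsE pr.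
have [le1 le2] := parse_le ps; have ltp := shape_gt0 sh.
have ler : r <= n by case: sh => /seg_le[].
have lem : size gs <= n by lia.
have h := has_shape sh og lem; have [l1 l2] := gate_args_le sh og lem.
have h' := has_pre ps.
exists p, r; split=> //.
by_kind_rule node_rule (gate_kind g)
  [:: s; p; size gs; r; (gate_args g p r).1; (gate_args g p r).2].
exact: ordered_args sh _ _ _.
Qed.

Lemma has_node_input s m x : node w s m (GInput x) ->
  exists p q, seg w p q (binary x) /\ has (Node KInput) s m p q.
Proof.
move=> /has_node[p [r [[/seg_cons[_ sx] _] h]]].
by exists p.+1, r.
Qed.

Lemma has_node_const s m b : node w s m (GConst b) ->
  has (Node (KConst b)) s m 0 0.
Proof. by case/has_node=> [p [r []]]. Qed.

Lemma has_node_not s m i : node w s m (GNot i) -> has (Node KNot) s m i 0.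
Proof. by case/has_node=> [p [r []]]. Qed.

Lemma has_node_op s m o i j : node w s m (GOp o i j) ->
  has (Node (KOp o)) s m i j.
Proof. by case: o => /has_node[p [r []]]. Qed.

Lemma node_wire_le s m g i : node w s m g -> i \in wires g -> i <= n.
Proof.
move=> nm; have [_ lem] := node_le nm; have := node_ordered nm.
by case: g nm => [x|b|j|j k|j k] nm //=; rewrite !inE; lia.
Qed.

Lemma has_wire s m g i : node w s m g -> i \in wires g -> has Wire s m i 0.
Proof.
move=> nm ig; have lei := node_wire_le nm ig; have [les lem] := node_le nm.
have op o j k : node w s m (GOp o j k) -> i \in [:: j; k] -> has Wire s m i 0.
  move=> nm'; have h := has_node_op nm'.
  have lej : j <= n by apply: node_wire_le nm' _; rewrite wires_GOp !inE eqxx.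
  have lek : k <= n by apply: node_wire_le nm' _; rewrite wires_GOp !inE eqxx orbT.
  rewrite !inE => /orP[]/eqP ei; rewrite ei.
    by by_bool_rule wire_left o [:: s; m; j; k].
  by by_bool_rule wire_right o [:: s; m; j; k].
case: g nm ig => [x|b|j|j k|j k] nm //=.
- rewrite inE => /eqP ei; rewrite -ei in nm; have h := has_node_not nm.
  by by_rule wire_not [:: s; m; i].
- exact: (op true).
- exact: (op false).
Qed.

Lemma has_upto s i l : s <= n -> i <= n -> l <= n ->
  meaning w Upto s i l 0 -> has Upto s i l 0.
Proof.
move=> les + lel; elim: i => [_ _|i IH lei used].
  by by_rule upto_nil [:: s; l].
have h : has Upto s i l 0.
  by apply: IH => [|i' lti]; [exact: ltnW | apply: used; exact: ltnW].
have [m [g [ltm nm ig]]] := used i (ltnSn i).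
have h' := has_wire nm ig; have [_ lem] := node_le nm.
by by_rule upto_cons [:: s; i; l; m].
Qed.

Lemma has_same s i t j f : den w s i f -> den w t j f -> has Same s i t j.
Proof.
move=> d; elim: d j =>
  {i f} [i x ni|i b ni|i i1 f ni di IH|o i i1 i2 f g ni d1 IH1 d2 IH2] j.
- move=> /[dup] dj /den_node nj.
  have [les lei] := node_le ni; have [let_ lej] := node_le nj.
  have [p [q [sp h]]] := has_node_input ni.
  have [p' [q' [sp' h']]] := has_node_input nj.
  have [lep leq] := seg_le sp; have [lep' leq'] := seg_le sp'.
  have h'' : has Str p q p' q'.
    pose bs := [seq odd (x %/ 2 ^ k) | k <- iota 0 (up_log 2 x.+1)].
    have ebs : binary x = [seq SBit b | b <- bs] by rewrite -map_comp.
    by rewrite ebs in sp sp'; apply: has_str sp sp'.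
  by by_rule same_input [:: s; i; t; j; p; q; p'; q'].
- move=> /den_node nj.
  have [les lei] := node_le ni; have [let_ lej] := node_le nj.
  have h := has_node_const ni; have h' := has_node_const nj.
  by by_bool_rule same_const b [:: s; i; t; j].
- move=> /den_node[j1 nj dj].
  have [les lei] := node_le ni; have [let_ lej] := node_le nj.
  have h := has_node_not ni; have h' := has_node_not nj; have h'' := IH _ dj.
  have [_ lei1] := den_le di; have [_ lej1] := den_le dj.
  by by_rule same_not [:: s; i; t; j; i1; j1].
- move=> /den_Op[j1 [j2 [nj dj1 dj2]]].
  have [les lei] := node_le ni; have [let_ lej] := node_le nj.
  have h := has_node_op ni; have h' := has_node_op nj.
  have h1 := IH1 _ dj1; have h2 := IH2 _ dj2.
  have [_ lei1] := den_le d1; have [_ lei2] := den_le d2.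
  have [_ lej1] := den_le dj1; have [_ lej2] := den_le dj2.
  by by_bool_rule same_op o [:: s; i; t; j; i1; i2; j1; j2].
Qed.

Lemma has_inst s i t j f g : den w s i f -> den w t j g ->
  BA_instance f g -> has Inst s i t j.
Proof.
move=> df dg fg; have [les lei] := den_le df; have [let_ lej] := den_le dg.
case: fg df dg => {f g} [b|o f|o f|o f g|o f g h|o f g h].
- move=> /den_node[a ni /[dup] /den_le[_ lea] /den_node na] /den_node nj.
  have h1 := has_node_not ni; have h2 := has_node_const na.
  have h3 := has_node_const nj.
  by by_bool_rule inst_neg b [:: s; i; t; j; a].
- move=> /den_Op[a [b [ni da db]]] dj.
  have [_ lea] := den_le da; have [_ leb] := den_le db.
  have h1 := has_node_op ni; have h2 := has_node_const (den_node da).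
  have h3 := has_same db dj.
  by by_bool_rule inst_unit o [:: s; i; t; j; a; b].
- move=> /den_Op[a [b [ni da /[dup] /den_le[_ leb] /den_node[c nb dc]]]] /den_node nj.
  have [_ lea] := den_le da; have [_ lec] := den_le dc.
  have h1 := has_node_op ni; have h2 := has_node_not nb.
  have h3 := has_same da dc; have h4 := has_node_const nj.
  by by_bool_rule inst_compl o [:: s; i; t; j; a; b; c].
- move=> /den_Op[a [b [ni da db]]] /den_Op[c [d [nj dc dd]]].
  have [_ lea] := den_le da; have [_ leb] := den_le db.
  have [_ lec] := den_le dc; have [_ led] := den_le dd.
  have h1 := has_node_op ni; have h2 := has_node_op nj.
  have h3 := has_same da dd; have h4 := has_same db dc.
  by by_bool_rule inst_comm o [:: s; i; t; j; a; b; c; d].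
- move=> /den_Op[a [b [ni da /[dup] db /den_Op[c [d [nb dc dd]]]]]].
  move=> /den_Op[e [k [nj /[dup] de /den_Op[l [m [ne dl dm]]] dk]]].
  have [_ lea] := den_le da; have [_ leb] := den_le db.
  have [_ lec] := den_le dc; have [_ led] := den_le dd.
  have [_ lee] := den_le de; have [_ lek] := den_le dk.
  have [_ lel] := den_le dl; have [_ lem] := den_le dm.
  have h1 := has_node_op ni; have h2 := has_node_op nb.
  have h3 := has_node_op nj; have h4 := has_node_op ne.
  have h5 := has_same da dl; have h6 := has_same dc dm.
  have h7 := has_same dd dk.
  by by_bool_rule inst_assoc o [:: s; i; t; j; a; b; c; d; e; k; l; m].
- move=> /den_Op[a [b [ni da /[dup] db /den_Op[c [d [nb dc dd]]]]]].
  move=> /den_Op[e [k [nj /[dup] de /den_Op[l [m [ne dl dm]]]]]].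
  move=> /[dup] dk /den_Op[x [y [nk dx dy]]].
  have [_ lea] := den_le da; have [_ leb] := den_le db.
  have [_ lec] := den_le dc; have [_ led] := den_le dd.
  have [_ lee] := den_le de; have [_ lek] := den_le dk.
  have [_ lel] := den_le dl; have [_ lem] := den_le dm.
  have [_ lex] := den_le dx; have [_ ley] := den_le dy.
  have h1 := has_node_op ni; have h2 := has_node_op nb.
  have h3 := has_node_op nj; have h4 := has_node_op ne.
  have h5 := has_node_op nk.
  have h6 := has_same da dl; have h7 := has_same dc dm.
  have h8 := has_same da dx; have h9 := has_same dd dy.
  by by_bool_rule inst_distr o [:: s; i; t; j; a; b; c; d; e; k; l; m; x; y].
Qed.

Lemma has_near s i t j f g : den w s i f -> den w t j g ->
  near f g -> has Near s i t j.
Proof.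
move=> + + fg; elim: fg i j =>
  {f g} [f g fg|f g gf|f g _ IH|o f g h _ IH|o f g h _ IH] i j df dg;
  have [les lei] := den_le df; have [let_ lej] := den_le dg.
- have hi := has_inst df dg fg.
  by by_rule near_inst [:: s; i; t; j].
- have hi := has_inst dg df gf.
  by by_rule near_inst_sym [:: s; i; t; j].
- have [i1 ni di] := den_node df; have [j1 nj dj] := den_node dg.
  have [_ lei1] := den_le di; have [_ lej1] := den_le dj.
  have h1 := has_node_not ni; have h2 := has_node_not nj; have h3 := IH _ _ di dj.
  by by_rule near_not [:: s; i; t; j; i1; j1].
- have [i1 [i2 [ni di1 di2]]] := den_Op df.
  have [j1 [j2 [nj dj1 dj2]]] := den_Op dg.
  have [_ lei1] := den_le di1; have [_ lei2] := den_le di2.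
  have [_ lej1] := den_le dj1; have [_ lej2] := den_le dj2.
  have h1 := has_node_op ni; have h2 := has_node_op nj.
  have h3 := IH _ _ di1 dj1; have h4 := has_same di2 dj2.
  by by_bool_rule near_left o [:: s; i; t; j; i1; i2; j1; j2].
- have [i1 [i2 [ni di1 di2]]] := den_Op df.
  have [j1 [j2 [nj dj1 dj2]]] := den_Op dg.
  have [_ lei1] := den_le di1; have [_ lei2] := den_le di2.
  have [_ lej1] := den_le dj1; have [_ lej2] := den_le dj2.
  have h1 := has_node_op ni; have h2 := has_node_op nj.
  have h3 := has_same di1 dj1; have h4 := IH _ _ di2 dj2.
  by by_bool_rule near_right o [:: s; i; t; j; i1; i2; j1; j2].
Qed.

Lemma circuit_ordered m (C : circuit m) k : k < size C ->
  gate_ordered k (nth (GConst false) C k).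
Proof. by move/circuit_wf; case: nth. Qed.

Lemma circuit_upto m (C : circuit m) s p : parse w s p C ->
  meaning w Upto s (size C).-1 (size C) 0.
Proof.
move=> ps i /circuit_out /(has_nthP (GConst false))[k ltk ig].
by exists k, (nth (GConst false) C k); split=> //; apply: parse_node ps ltk.
Qed.

Lemma circuit_den m (C : circuit m) s p : parse w s p C ->
  den w s (size C).-1 (Fla C).
Proof.
move=> ps; rewrite Fla_nth; apply: parse_den ps _.
by rewrite ltn_predL; apply: circuit_gt0.
Qed.

(** The rules are complete for acceptance: the facts that are needed are derived
    along the reading of the two codes, the formulas of gates and the
    definition of [near]. *)
Lemma has_accept : accepted w -> has Accept 0 0 0 0.
Proof.
case=> n1 [n2 [A [B [ew AB]]]].
have [||||p [pA lep ep]] := @encode_gates_parse w 0 A (SSep :: encode_gates B).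
- by [].
- by rewrite drop0.
- by [].
- exact: circuit_ordered.
have ltp : p < n by move: (congr1 size ep); rewrite size_drop /=; lia.
have eSep : onth w p = Some SSep by rewrite -ohead_drop ep.
have ep1 : drop p.+1 w = encode_gates B ++ [::].
  by rewrite -[p.+1]add1n -drop_drop ep /= drop0 cats0.
have [||q [pB leq eq]] := encode_gates_parse ltp ep1.
- by [].
- exact: circuit_ordered.
have eqn : q = n by move: (congr1 size eq); rewrite size_drop /=; lia.
rewrite eqn in pB.
have hA := has_pre pA; have hB := has_pre pB.
have [leA _] := parse_le pA; have [leB _] := parse_le pB.
have uA := has_upto (leq0n _) _ _ (circuit_upto pA).
have uB := has_upto ltp _ _ (circuit_upto pB).
have hN := has_near (circuit_den pA) (circuit_den pB) ((simBA_near _ _).1 AB).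
have := circuit_gt0 A; have := circuit_gt0 B.
set a := size A in hA leA uA hN *; set b := size B in hB leB uB hN *.
move=> gtb gta.
have {}uA : has Upto 0 a.-1 a 0 by apply: uA; lia.
have {}uB : has Upto p.+1 b.-1 b 0 by apply: uB; lia.
by by_rule accept [:: p; a.-1; b.-1; a; b].
Qed.

End Completeness.

Theorem lemma3p2 :
  PTIME (fun w : seq symbol =>
    exists (n m : nat) (A : circuit n) (B : circuit m),
      w = encode_pair A B /\ approx A B).
Proof.
have sz : scoped_expr 0 (EBound 22) by [].
have sc : scoped 1 (rules_form tag_code rules) by [].
apply: (PTIME_least_fixpoint sz sc) => w.
have e0 : addr tag_code (size w) Accept 0 0 0 0 = 0 by rewrite /addr !mul0n.
split=> [L X clX|all_X].
  by rewrite -e0; apply: has_accept clX L.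
have := all_X _ (closed_addressed tag_code_inj (@rules_sound w)).
by move=> /(_ Accept 0 0 0 0 isT isT isT isT (esym e0)).
Qed.
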